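(* Let $F$ be a conformal semi-invariant submersion with dilation $\lambda$ from a Kähler manifold $(M,g_M,J)$ to a Riemannian manifold $(N,g_N)$, with $\ker F_*=D_1\oplus D_2$. Then the distribution $(\ker F_* )^\perp$ defines a totally geodesic foliation on $M$ if and only if, for all $X,Y\in\Gamma((\ker F_* )^\perp)$ and $W\in\Gamma(D_2)$, $$A_X\mathcal{C}Y+\mathcal{V}\nabla^M_X\mathcal{B}Y\in\Gamma(D_2)$$ and $$\lambda^2\,g_M\big(A_X\mathcal{B}Y-\mathcal{C}Y(\ln\lambda)X+g_M(X,\mathcal{C}Y)\,\mathrm{grad}\ln\lambda,\;JW\big)=g_N(\nabla^F_XF_*JW,\,F_*\mathcal{C}Y).$$
   Context: A Kähler manifold $(M,g_M,J)$ is a Riemannian manifold with a $(1,1)$-tensor $J$ such that $J^2=-I$, $g_M(JX,JY)=g_M(X,Y)$ and $\nabla^M J=0$, where $\nabla^M$ is the Levi-Civita connection. A smooth submersion $F:(M,g_M)\to(N,g_N)$ is horizontally conformal with dilation $\lambda$ ($\lambda$ a positive function on $M$) if $\lambda^2g_M(X,Y)=g_N(F_*X,F_*Y)$ for all $X,Y\in\Gamma((\ker F_* )^\perp)$. It is a conformal semi-invariant submersion if in addition there is a distribution $D_1\subseteq\ker F_*$ with $\ker F_*=D_1\oplus D_2$, $J(D_1)=D_1$, $J(D_2)\subseteq(\ker F_* )^\perp$, where $D_2$ is the orthogonal complement of $D_1$ in $\ker F_*$. Let $\mu$ be the orthogonal complement of $JD_2$ in $(\ker F_* )^\perp$. For $X\in\Gamma((\ker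 F_* )^\perp)$ write $JX=\mathcal{B}X+\mathcal{C}X$ with $\mathcal{B}X\in\Gamma(D_2)$, $\mathcal{C}X\in\Gamma(\mu)$. $\mathcal{V}$ and $\mathcal{H}$ denote the orthogonal projections onto $\ker F_*$ and $(\ker F_* )^\perp$, and $A$ is O'Neill's tensor $A_EG=\mathcal{V}\nabla^M_{\mathcal{H}E}\mathcal{H}G+\mathcal{H}\nabla^M_{\mathcal{H}E}\mathcal{V}G$. $\nabla^F$ is the pullback connection on $F^{-1}TN$ induced by the Levi-Civita connection of $N$. $Z(\ln\lambda)$ is the derivative of $\ln\lambda$ along $Z$, and $\mathrm{grad}$ is the gradient with respect to $g_M$. A distribution $\mathcal{D}$ on $M$ defines a totally geodesic foliation on $M$ if $\nabla^M_XY\in\Gamma(\mathcal{D})$ for all $X,Y\in\Gamma(\mathcal{D})$ (it is then integrable with totally geodesic leaves). *)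

(* Defs.v *)
From mathcomp Require Import all_boot all_order all_algebra.
From mathcomp Require Import all_classical all_reals all_analysis.

Set Implicit Arguments.
Unset Strict Implicit.
Unset Printing Implicit Defensive.

Import Order.TTheory GRing.Theory Num.Theory.
Import numFieldNormedType.Exports.

Local Open Scope classical_set_scope.
Local Open Scope ring_scope.

Section Euclidean.
Variables (R : realType) (m : nat).

(* C^k functions on an open set U of R^m. *)
Fixpoint Ck (k : nat) (U : set 'rV[R]_m) (f : 'rV[R]_m -> R) : Prop :=
  match k with
  | 0 => forall x, U x -> {for x, continuous f}
  | k'.+1 => (forall x, U x -> differentiable f x) /\
             forall v, Ck k' U (fun x => 'd f x v)
  end.

Definition smooth_on (U : set 'rV[R]_m) (f : 'rV[R]_m -> R) : Prop :=
  forall k, Ck k U f.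

End Euclidean.

(* [cmap c] and [cinv c] are total functions, but only their values on
   [cdom c] and on [cmap c @` cdom c], respectively, are meaningful. *)
Record chart (R : realType) (m : nat) (T : topologicalType) := Chart {
  cdom : set T;
  cmap : T -> 'rV[R]_m;
  cinv : 'rV[R]_m -> T;
  cdom_open : open cdom;
  cimg_open : open (cmap @` cdom);
  cmapK : forall p, cdom p -> cinv (cmap p) = p;
  cmap_cont : {within cdom, continuous cmap};
  cinv_cont : {within cmap @` cdom, continuous cinv} }.

Definition compatible (R : realType) (m : nat) (T : topologicalType)
    (c c' : chart R m T) : Prop :=
  forall i, smooth_on (cmap c @` (cdom c `&` cdom c'))
                      (fun x => cmap c' (cinv c x) ord0 i).

Record manifold (R : realType) (m : nat) := Manifold {
  carrier :> topologicalType;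
  atlas : set (chart R m carrier);
  hausdorff_carrier : hausdorff_space carrier;
  second_countable_carrier : @second_countable carrier;
  atlas_cover : forall p : carrier, exists c, atlas c /\ cdom c p;
  atlas_compatible : forall c c', atlas c -> atlas c' -> compatible c c' }.

Section Calculus.
Variables (R : realType) (m : nat) (M : manifold R m).

Definition chart_at (p : M) : chart R m M := projT1 (cid (atlas_cover p)).

(* A tangent vector at [p] is represented by its components in the chart
   [chart_at p]. Since that chart depends on [p], the components of a smooth
   field need not be smooth functions of [p]; smoothness of fields is
   [smooth_along] below. *)
Definition tangent (p : M) : Type := 'rV[R]_m.

Definition smooth_at (f : M -> R) (p : M) : Prop :=
  exists U, [/\ open U, U (cmap (chart_at p) p)
             & smooth_on U (f \o cinv (chart_at p))].

(* The derivative v(f) of the function f along v in T_p M. *)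
Definition dirder (f : M -> R) (p : M) (v : tangent p) : R :=
  'd (f \o cinv (chart_at p) : 'rV[R]_m -> R) (cmap (chart_at p) p) v.

End Calculus.

Section Maps.
Variables (R : realType) (m n : nat) (M : manifold R m) (N : manifold R n).
Implicit Type F : M -> N.

Definition smooth_map F : Prop :=
  continuous F /\
  forall p i, smooth_at (fun q => cmap (chart_at (F p)) (F q) ord0 i) p.

Definition differential F (p : M) (v : tangent p) : tangent (F p) :=
  'd (cmap (chart_at (F p)) \o F \o cinv (chart_at p) : 'rV[R]_m -> 'rV[R]_n)
     (cmap (chart_at p) p) v.

(* Not necessarily smooth sections of F^{-1}TN. Vector fields on M are the
   sections along the identity of M. *)
Definition section_along F : Type := forall p : M, tangent (F p).

(* V is smooth on a neighbourhood of p: V f is smooth near p for every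
   function f that is smooth near F p. *)
Definition smooth_along F (V : section_along F) (p : M) : Prop :=
  forall f, smooth_at f (F p) -> smooth_at (fun q => dirder f (V q)) p.

End Maps.

Definition vfield (R : realType) (m : nat) (M : manifold R m) : Type :=
  section_along (@id M).

Definition smooth_field (R : realType) (m : nat) (M : manifold R m)
    (X : vfield M) (p : M) : Prop := smooth_along (F := id) X p.

Section Connections.
Variables (R : realType) (m n : nat) (M : manifold R m) (N : manifold R n).

(* Connections on F^{-1}TN, as operators on local sections: [nabla p v V] is
   the covariant derivative at p of V along v. It is applied to total
   families V, but is constrained only when V is smooth near p; by
   [conn_local] it then depends on the germ of V at p only. *)
Definition conn_op (F : M -> N) : Type :=
  forall p : M, tangent p -> section_along F -> tangent (F p).

Record is_connection (F : M -> N) (nabla : conn_op F) : Prop := {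
  conn_local : forall p (v : tangent p) (V V' : section_along F),
    smooth_along V p -> (\forall q \near p, V q = V' q) ->
    nabla p v V = nabla p v V';
  conn_linear : forall p (V : section_along F) (a : R) (v w : tangent p),
    smooth_along V p ->
    nabla p (a *: v + w) V = a *: nabla p v V + nabla p w V;
  conn_add : forall p (v : tangent p) (V V' : section_along F),
    smooth_along V p -> smooth_along V' p ->
    nabla p v (fun q => V q + V' q) = nabla p v V + nabla p v V';
  conn_leibniz : forall p (v : tangent p) (f : M -> R) (V : section_along F),
    smooth_at f p -> smooth_along V p ->
    nabla p v (fun q => f q *: V q) = dirder f v *: V p + f p *: nabla p v V;
  conn_smooth : forall p (X : vfield M) (V : section_along F),
    smooth_field X p -> smooth_along V p ->
    smooth_along (F := F) (fun q => nabla q (X q) V) p }.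

End Connections.

Section Riemannian.
Variables (R : realType) (m : nat) (M : manifold R m).

Record metric := Metric {
  inner :> forall p : M, tangent p -> tangent p -> R;
  inner_sym : forall p (u v : tangent p), inner u v = inner v u;
  inner_linear : forall p (a : R) (u v w : tangent p),
    inner (a *: u + v) w = a * inner u w + inner v w;
  inner_pos : forall p (v : tangent p), v != 0 -> 0 < inner v v;
  inner_smooth : forall (X Y : vfield M) p,
    smooth_field X p -> smooth_field Y p ->
    smooth_at (fun q => inner (X q : tangent q) (Y q : tangent q)) p }.

Record is_levi_civita (g : metric) (nabla : conn_op (@id M)) : Prop := {
  lc_connection : is_connection nabla;
  lc_metric : forall p (v : tangent p) (Y Z : vfield M),
    smooth_field Y p -> smooth_field Z p ->
    dirder (fun q => g q (Y q) (Z q)) v =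
      g p (nabla p v Y) (Z p) + g p (Y p) (nabla p v Z);
  (* nabla_X Y - nabla_Y X = [X, Y], evaluated on functions *)
  lc_torsion : forall p (X Y : vfield M) (f : M -> R),
    smooth_field X p -> smooth_field Y p -> smooth_at f p ->
    dirder f (nabla p (X p) Y - nabla p (Y p) X : tangent p) =
      dirder (fun q => dirder f (Y q : tangent q)) (X p : tangent p) -
      dirder (fun q => dirder f (X q : tangent q)) (Y p : tangent p) }.

Definition gradient (g : metric) (f : M -> R) : vfield M :=
  fun p => xget 0 [set u : tangent p | forall v, g p u v = dirder f v].

Definition subspaces : Type := forall p : M, set (tangent p).

(* Smooth subbundles of TM; the rank is locally constant. *)
Definition is_distribution (D : subspaces) : Prop :=
  forall p, exists (r : nat) (E : 'I_r -> vfield M),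
    (forall i, smooth_field (E i) p) /\
    \forall q \near p,
      (forall c : 'I_r -> R,
         \sum_i c i *: (E i q : tangent q) = 0 -> forall i, c i = 0) /\
      D q = [set v | exists c : 'I_r -> R,
                       v = \sum_i c i *: (E i q : tangent q)].

(* Global smooth sections of D. *)
Definition gsection (D : subspaces) (X : vfield M) : Prop :=
  (forall p, smooth_field X p) /\ forall p, D p (X p).

(* The orthogonal complement of D2 in D1. *)
Definition orth_in (g : metric) (D1 D2 : subspaces) : subspaces :=
  fun p => [set v | D1 p v /\ forall w, D2 p w -> g p v w = 0].

Definition orth (g : metric) (D : subspaces) : subspaces :=
  orth_in g (fun p => setT) D.

Definition proj (g : metric) (D : subspaces) (X : vfield M) : vfield M :=
  fun p => xget 0 [set u | D p u /\ orth g D (X p - u : tangent p)].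

(* The component in D1 with respect to a direct sum of D1 and D2. *)
Definition component (D1 D2 : subspaces) (X : vfield M) : vfield M :=
  fun p => xget 0 [set u | D1 p u /\ D2 p (X p - u : tangent p)].

Definition defines_tot_geodesic_foliation (nabla : conn_op (@id M))
    (D : subspaces) : Prop :=
  forall X Y : vfield M, gsection D X -> gsection D Y ->
    gsection D (fun p => nabla p (X p) Y).

Definition endo : Type := forall p : M, {linear tangent p -> tangent p}.

Definition endo_app (J : endo) (X : vfield M) : vfield M :=
  fun p => J p (X p).

Record is_kahler (g : metric) (nabla : conn_op (@id M)) (J : endo) : Prop := {
  kahler_levi_civita : is_levi_civita g nabla;
  kahler_smooth : forall (X : vfield M) p,
    smooth_field X p -> smooth_field (endo_app J X) p;
  kahler_square : forall p (v : tangent p), J p (J p v) = - v;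
  kahler_hermitian : forall p (u v : tangent p),
    g p (J p u) (J p v) = g p u v;
  kahler_parallel : forall p (v : tangent p) (Y : vfield M),
    smooth_field Y p -> nabla p v (endo_app J Y) = J p (nabla p v Y) }.

End Riemannian.

Section Submersions.
Variables (R : realType) (m n : nat) (M : manifold R m) (N : manifold R n).
Variables (gM : metric M) (gN : metric N) (F : M -> N).

Definition vert : subspaces M := fun p => [set v | differential F v = 0].

Definition horiz : subspaces M := orth gM vert.

Definition is_submersion : Prop :=
  smooth_map F /\
  forall p (w : tangent (F p)), exists v : tangent p, differential F v = w.

Definition push (X : vfield M) : section_along F :=
  fun p => differential F (X p : tangent p).

Definition is_horizontally_conformal (lam : M -> R) : Prop :=
  (forall p, 0 < lam p) /\
  forall p (u v : tangent p), horiz u -> horiz v ->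
    lam p ^+ 2 * gM p u v = gN (F p) (differential F u) (differential F v).

Definition compl_D2 (D1 : subspaces M) : subspaces M := orth_in gM vert D1.

Record is_conformal_semi_invariant (J : endo M) (lam : M -> R)
    (D1 : subspaces M) : Prop := {
  csi_submersion : is_submersion;
  csi_conformal : is_horizontally_conformal lam;
  csi_distribution : is_distribution D1;
  csi_sub : forall p (v : tangent p), D1 p v -> vert v;
  csi_D1 : forall p, J p @` D1 p = D1 p;
  csi_D2 : forall p (w : tangent p), compl_D2 D1 w -> horiz (J p w : tangent p) }.

(* mu, the orthogonal complement of J D_2 in (ker F_* )^\perp *)
Definition mu (J : endo M) (D1 : subspaces M) : subspaces M :=
  orth_in gM horiz (fun p => J p @` @compl_D2 D1 p).

(* J X = B X + C X for X horizontal *)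
Definition Bpart (J : endo M) (D1 : subspaces M) (X : vfield M) : vfield M :=
  component (compl_D2 D1) (mu J D1) (endo_app J X).

Definition Cpart (J : endo M) (D1 : subspaces M) (X : vfield M) : vfield M :=
  component (mu J D1) (compl_D2 D1) (endo_app J X).

Definition vproj : vfield M -> vfield M := proj gM vert.

Definition hproj : vfield M -> vfield M := proj gM horiz.

Definition covder (nabla : conn_op (@id M)) (X Y : vfield M) : vfield M :=
  fun p => nabla p (X p) Y.

Definition oneill_A (nabla : conn_op (@id M)) (E G : vfield M) : vfield M :=
  fun p => vproj (covder nabla (hproj E) (hproj G)) p
           + hproj (covder nabla (hproj E) (vproj G)) p.

Definition is_pullback_connection (nablaN : conn_op (@id N))
    (nablaF : conn_op F) : Prop :=
  is_connection nablaF /\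
  forall p (v : tangent p) (V : vfield N), smooth_field V (F p) ->
    nablaF p v (fun q => V (F q)) = nablaN (F p) (differential F v) V.

End Submersions.

(* Main.v *)
(** Since $J$ is parallel and orthogonal, $g(\nabla_X Y, V) =
    g(\nabla_X BY + \nabla_X CY, JV)$ for vertical $V$. For $V$ in $D_1$, $JV$
    is vertical and only the vertical part of $J \nabla_X Y$ matters; it is
    the first expression of the theorem. For $V = W$ in $D_2$, $JW$ is
    horizontal and orthogonal to $CY$, so the second term is
    $-g(CY, \nabla_X JW)$, which horizontal conformality expresses through
    $\nabla^F$ and the derivatives of $\ln\lambda$.

    The last step is a Koszul argument. The form
    $T(X,Y) = \nabla^F_X F_*Y - F_*\nabla_X Y$ is symmetric because $\nabla^F$
    is torsion free along $F$, and differentiating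
    $\lambda^2 g(Y,Z) = g_N(F_*Y, F_*Z)$ gives
    $g_N(T(X,Y),F_*Z) + g_N(T(X,Z),F_*Y) = X(\lambda^2) g(Y,Z)$, which
    determines $T$ on horizontal fields.

    In the converse direction no extension of tangent vectors to global
    sections is needed: taking for $W$ the $D_2$-component of $\nabla_X Y$
    itself makes the second condition say that this component vanishes. *)
Require Import Defs.
From mathcomp Require Import all_boot all_order all_algebra.
From mathcomp Require Import all_classical all_reals all_analysis.
From mathcomp Require Import ring lra.

Import Order.TTheory GRing.Theory Num.Theory.
Import numFieldNormedType.Exports.

Local Open Scope classical_set_scope.
Local Open Scope ring_scope.

Set Implicit Arguments.
Unset Strict Implicit.
Unset Printing Implicit Defensive.

(** * Calculus of smooth functions on R^m *)

Lemma open_near (T : topologicalType) (U : set T) (x : T) :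
  open U -> U x -> nbhs x U.
Proof. by move=> oU Ux; exact: open_nbhs_nbhs. Qed.

Section EuclideanCalculus.
Variable R : realType.

(** The little-o expansion of [f] at [x] transfers to [g], and the differential is the unique
    continuous linear map with such an expansion. *)
Lemma near_diff (V W : normedModType R) (f g : V -> W) (x : V) :
  (\forall y \near x, f y = g y) -> differentiable f x ->
  differentiable g x /\ 'd g x = 'd f x :> (V -> W).
Proof.
move=> fg df; have fgx : f x = g x by exact: nbhs_singleton fg.
suff H : g \o shift x = cst (g x) + 'd f x +o_ 0 id.
  have E : 'd g x = 'd f x :> (V -> W).
    by apply: diff_unique H; exact: diff_continuous.
  split=> //; apply/diff_locallyP; rewrite E; split=> //.
  exact: diff_continuous.
apply/eqaddoP => _/posnumP[e].
have /eqaddoP/(_ e%:num (gt0 e)) := diff_locally df.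
have fg0 : \forall h \near (0 : V), f (h + x) = g (h + x).
  by rewrite (near_shift 0 x) subr0 in fg; near=> h; near: h; apply: filterS fg => h /=; rewrite /= ?addr0.
apply: filter_app; rewrite /= near_simpl; near=> h.
have fgh : f (h + x) = g (h + x) by near: h.
by rewrite !fctE /= fgh fgx.
Unshelve. all: by end_near. Qed.

Section DiffAt.
Variables (m : nat) (f g : 'rV[R]_m -> R) (x v : 'rV[R]_m).

Lemma diffD_at : differentiable f x -> differentiable g x ->
  'd (fun y => f y + g y) x v = 'd f x v + 'd g x v.
Proof. by move=> df dg; exact: (congr1 (fun h => h v) (diffD df dg)). Qed.

Lemma diffM_at : differentiable f x -> differentiable g x ->
  'd (fun y => f y * g y) x v = f x * 'd g x v + g x * 'd f x v.
Proof. by move=> df dg; exact: (congr1 (fun h => h v) (diffM df dg)). Qed.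

Lemma diffV_at : differentiable f x -> f x != 0 ->
  'd (fun y => (f y)^-1) x v = - (f x) ^- 2 * 'd f x v.
Proof. by move=> df fx; exact: (congr1 (fun h => h v) (diffV df fx)). Qed.

Lemma near_diff_at : (\forall y \near x, f y = g y) -> differentiable f x ->
  'd g x v = 'd f x v.
Proof. by move=> fg df; exact: (congr1 (@^~ v) (near_diff fg df).2). Qed.

End DiffAt.

Lemma diff_comp_at m l (W : normedModType R) (phi : 'rV[R]_m -> 'rV[R]_l)
    (f : 'rV[R]_l -> W) x v :
  differentiable phi x -> differentiable f (phi x) ->
  'd (f \o phi) x v = 'd f (phi x) ('d phi x v).
Proof. by move=> dphi df; exact: (congr1 (@^~ v) (diff_comp dphi df)). Qed.

Lemma diff_coord m (x v : 'rV[R]_m) i :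
  'd (fun y : 'rV[R]_m => y ord0 i) x v = v ord0 i.
Proof.
have @f : {linear 'rV[R]_m -> R}.
  by exists (fun y : 'rV[R]_m => y ord0 i); do 2![eexists]; do ?[constructor];
     rewrite ?mxE// => ? *; rewrite ?mxE//; move=> ?; rewrite !mxE.
by rewrite (_ : (fun _ => _) = f) // diff_lin //; exact: coord_continuous.
Qed.

(** * Closure properties of functions of class C^k on an open set *)

Section Ck.
Variable m : nat.
Implicit Types (U V : set 'rV[R]_m) (f g : 'rV[R]_m -> R).

Lemma Ck_subset k U V f : U `<=` V -> Ck k V f -> Ck k U f.
Proof.
move=> UV; elim: k f => [|k IH] f /=; first by move=> h x /UV; exact: h.
by case=> h1 h2; split=> [x /UV|v]; [exact: h1|apply: IH].
Qed.

(** Openness of [U] turns equality on [U] into equality of germs at each of its points, which is all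
    that differentials see. *)
Lemma Ck_eq k U f g : open U -> (forall x, U x -> f x = g x) ->
  Ck k U f -> Ck k U g.
Proof.
move=> oU; elim: k f g => [|k IH] f g fg /=.
  move=> h x Ux; have fgx : \forall y \near x, f y = g y.
    by apply: filterS fg _; exact: open_near.
  have h' : f @ x --> f x := h x Ux.
  change (g @ x --> g x); rewrite -(fg _ Ux).
  exact: cvg_trans (@near_eq_cvg _ _ (nbhs x) _ f g fgx) h'.
case=> h1 h2.
have fgn x : U x -> \forall y \near x, f y = g y.
  by move=> Ux; apply: filterS fg _; apply: open_nbhs_nbhs.
split=> [x Ux|v]; first by case: (near_diff (fgn x Ux) (h1 x Ux)).
have E x : U x -> 'd f x v = 'd g x v.
  by move=> Ux; rewrite (near_diff_at v (fgn x Ux) (h1 x Ux)).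
exact: IH E (h2 v).
Qed.

Lemma CkW k U f : Ck k.+1 U f -> Ck k U f.
Proof.
elim: k f => [|k IH] f [h1 h2].
  by move=> x Ux; apply: differentiable_continuous; exact: h1.
by split=> // v; apply: IH (h2 v).
Qed.

Lemma Ck_cst k U (a : R) : Ck k U (fun=> a).
Proof.
elim: k a => [|k IH] a /=; first by move=> x _; exact: cst_continuous.
split=> [x _|v]; first exact: differentiable_cst.
rewrite (_ : (fun x => _) = fun=> 0); first exact: IH.
by apply/funext => x; rewrite diff_cst.
Qed.

Lemma CkD k U f g : open U -> Ck k U f -> Ck k U g ->
  Ck k U (fun x => f x + g x).
Proof.
move=> oU; elim: k f g => [|k IH] f g /=.
  by move=> hf hg x Ux; apply: continuousD; [exact: hf|exact: hg].
case=> f1 f2 [g1 g2]; split=> [x Ux|v].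
  by apply: differentiableD; [exact: f1|exact: g1].
have E x : U x -> 'd f x v + 'd g x v = 'd (fun y => f y + g y) x v.
  by move=> Ux; rewrite (diffD_at v (f1 x Ux) (g1 x Ux)).
exact: Ck_eq oU E (IH _ _ (f2 v) (g2 v)).
Qed.

Lemma CkM k U f g : open U -> Ck k U f -> Ck k U g ->
  Ck k U (fun x => f x * g x).
Proof.
move=> oU; elim: k f g => [|k IH] f g.
  by move=> hf hg x Ux; apply: continuousM; [exact: hf|exact: hg].
move=> hf hg; have := hf; have := hg.
case=> g1 g2 [f1 f2]; split=> [x Ux|v].
  by apply: differentiableM; [exact: f1|exact: g1].
have E x : U x ->
    f x * 'd g x v + g x * 'd f x v = 'd (fun y => f y * g y) x v.
  by move=> Ux; rewrite (diffM_at v (f1 x Ux) (g1 x Ux)).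
exact: Ck_eq oU E
  (CkD oU (IH _ _ (CkW hf) (g2 v)) (IH _ _ (CkW hg) (f2 v))).
Qed.

(** The derivative of 1/f is -(1/f)^2 df, so the induction hypothesis on 1/f itself and [CkM] give
    the step. *)
Lemma CkV k U f : open U -> (forall x, U x -> f x != 0) -> Ck k U f ->
  Ck k U (fun x => (f x)^-1).
Proof.
move=> oU f0; elim: k => [|k IH] hf.
  by move=> x Ux; apply: continuousV; [exact: f0|exact: hf].
have [f1 f2] := hf; split=> [x Ux|v].
  by apply: differentiableV; [exact: f1|exact: f0].
have IHV := IH (CkW hf).
have E x : U x -> (-1) * ((f x)^-1 * (f x)^-1) * 'd f x v =
    'd (fun y => (f y)^-1) x v.
  move=> Ux; rewrite (diffV_at v (f1 x Ux) (f0 x Ux)).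
  by rewrite mulN1r -invfM -expr2.
exact: Ck_eq oU E
  (CkM oU (CkM oU (Ck_cst _ _ _) (CkM oU IHV IHV)) (f2 v)).
Qed.

Lemma Ck_sum k U (I : Type) (r : seq I) (F : I -> 'rV[R]_m -> R) : open U ->
  (forall i, Ck k U (F i)) -> Ck k U (fun x => \sum_(i <- r) F i x).
Proof.
move=> oU hF; elim: r => [|i r IH].
  by under eq_fun do rewrite big_nil; exact: Ck_cst.
by under eq_fun do rewrite big_cons; apply: CkD.
Qed.

Lemma Ck_coord k U i : Ck k U (fun x : 'rV[R]_m => x ord0 i).
Proof.
case: k => [|k] /=; first by move=> x _; exact: coord_continuous.
split=> [x _|v]; first exact: differentiable_coord.
rewrite (_ : (fun x => _) = fun=> v ord0 i); first exact: Ck_cst.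
by apply/funext => x; rewrite diff_coord.
Qed.

End Ck.

Lemma differentiable_row m l (phi : 'rV[R]_m -> 'rV[R]_l) x :
  (forall i, differentiable (fun y => phi y ord0 i) x) -> differentiable phi x.
Proof.
move=> h.
have -> : phi = \sum_i (fun y => phi y ord0 i *: delta_mx ord0 i).
  by apply/funext => y; rewrite fct_sumE [LHS]row_sum_delta.
by apply: differentiable_sum => i; apply: differentiableZl.
Qed.

Lemma diff_row m l (phi : 'rV[R]_m -> 'rV[R]_l) x v i :
  differentiable phi x ->
  'd (fun y => phi y ord0 i) x v = 'd phi x v ord0 i.
Proof.
move=> h; have dc := @differentiable_coord R 1 l (phi x) ord0 i.
by rewrite -[RHS](diff_coord (phi x)) -(diff_comp_at v h dc).
Qed.

End EuclideanCalculus.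

Section EuclideanComposition.
Variable R : realType.

(** By the chain rule, a derivative of [f \o phi] is a sum of products of derivatives of components
    of [phi], which are smooth, with partial derivatives of [f] composed with [phi]; only the order
    in [f] drops. *)
Lemma Ck_comp m l k U V (f : 'rV[R]_l -> R) (phi : 'rV[R]_m -> 'rV[R]_l) :
  open U -> (forall x, U x -> V (phi x)) ->
  (forall i, smooth_on U (fun x => phi x ord0 i)) ->
  Ck k V f -> Ck k U (f \o phi).
Proof.
move=> oU UV sphi.
have dphi x : U x -> differentiable phi x.
  by move=> Ux; apply: differentiable_row => i; case: (sphi i 1%N) => + _; apply.
elim: k f => [|k IH] f.
  move=> hf x Ux; apply: continuous_comp; last by apply: hf; exact: UV.
  by apply: differentiable_continuous; exact: dphi.
case=> f1 f2; split=> [x Ux|v].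
  by apply: differentiable_comp; [exact: dphi|apply: f1; exact: UV].
have E x : U x ->
    \sum_i 'd (fun y => phi y ord0 i) x v * 'd f (phi x) (delta_mx ord0 i) =
    'd (f \o phi) x v.
  move=> Ux; rewrite (diff_comp_at v (dphi x Ux) (f1 _ (UV x Ux))).
  rewrite [in RHS](row_sum_delta ('d phi x v)) linear_sum.
  by apply: eq_bigr => i _; rewrite linearZ /= diff_row //; exact: dphi.
apply: (Ck_eq oU E); apply: (Ck_sum _ oU) => i; apply: (CkM oU).
  by case: (sphi i k.+1) => _; apply.
exact: IH (f2 (delta_mx ord0 i)).
Qed.

(** * Smoothness near a point of R^m *)

Section SmoothNear.

(** [smooth_at f p] unfolds to this notion for the local representative of [f] in the chart at [p].
    One neighbourhood serves all orders of differentiation. *)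
Definition smooth_near m (f : 'rV[R]_m -> R) (x : 'rV[R]_m) : Prop :=
  exists U, [/\ open U, U x & smooth_on U f].

Variable m : nat.
Implicit Types (f g : 'rV[R]_m -> R) (x : 'rV[R]_m).

Lemma smooth_near_nbhs f x : smooth_near f x ->
  \forall y \near x, smooth_near f y.
Proof.
case=> U [oU Ux sU]; by apply: filterS (open_near oU Ux) => y Uy; exists U.
Qed.

Lemma smooth_near_eq f g x : (\forall y \near x, f y = g y) ->
  smooth_near f x -> smooth_near g x.
Proof.
move=> fg [U [oU Ux sU]]; exists (U `&` [set y | f y = g y]^°); split.
- by apply: openI => //; exact: open_interior.
- by split.
- move=> k; apply: (@Ck_eq _ _ _ _ f).
  + by apply: openI => //; exact: open_interior.
  + by move=> y [_ /interior_subset].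
  + by apply: Ck_subset (sU k) => y [].
Qed.

Lemma smooth_near_differentiable f x : smooth_near f x -> differentiable f x.
Proof. by case=> U [_ Ux /(_ 1%N) [h _]]; exact: h. Qed.

Lemma smooth_near_continuous f x : smooth_near f x -> {for x, continuous f}.
Proof.
by move=> /smooth_near_differentiable; exact: differentiable_continuous.
Qed.

Lemma smooth_near_diff f x v : smooth_near f x ->
  smooth_near (fun y => 'd f y v) x.
Proof.
case=> U [oU Ux sU]; exists U; split=> // k.
by have [_ h] := sU k.+1; exact: h.
Qed.

Lemma smooth_near_cst a x : smooth_near (fun=> a) x.
Proof. by exists setT; split; [exact: openT| |move=> k; exact: Ck_cst]. Qed.

Lemma smooth_nearD f g x : smooth_near f x -> smooth_near g x ->
  smooth_near (fun y => f y + g y) x.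
Proof.
case=> U [oU Ux sU] [V [oV Vx sV]]; have oUV : open (U `&` V) by exact: openI.
exists (U `&` V); split=> // k.
by apply: CkD => //; [apply: Ck_subset (sU k)|apply: Ck_subset (sV k)] => y [].
Qed.

Lemma smooth_nearM f g x : smooth_near f x -> smooth_near g x ->
  smooth_near (fun y => f y * g y) x.
Proof.
case=> U [oU Ux sU] [V [oV Vx sV]]; have oUV : open (U `&` V) by exact: openI.
exists (U `&` V); split=> // k.
by apply: CkM => //; [apply: Ck_subset (sU k)|apply: Ck_subset (sV k)] => y [].
Qed.

Lemma smooth_nearV f x : f x != 0 -> smooth_near f x ->
  smooth_near (fun y => (f y)^-1) x.
Proof.
move=> fx0 sf; have [U [oU Ux sU]] := sf.
have h : \forall y \near x, f y != 0.
  have cf : f @ x --> f x := smooth_near_continuous sf.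
  exact: (cvgr_neq0 _ cf fx0).
exists (U `&` [set y | f y != 0]^°); split.
- by apply: openI => //; exact: open_interior.
- by split.
- move=> k; apply: CkV.
  + by apply: openI => //; exact: open_interior.
  + by move=> y [_ /interior_subset].
  + by apply: Ck_subset (sU k) => y [].
Qed.

End SmoothNear.

Lemma smooth_near_comp m l (f : 'rV[R]_l -> R) (phi : 'rV[R]_m -> 'rV[R]_l) x :
  (forall i, smooth_near (fun y => phi y ord0 i) x) -> smooth_near f (phi x) ->
  smooth_near (f \o phi) x.
Proof.
move=> sphi [V [oV Vx sV]].
have dphi : differentiable phi x.
  by apply: differentiable_row => i; exact: smooth_near_differentiable.
have [U hU] := choice sphi.
have nU : \forall y \near x, forall i, U i y.
  have nUi i : nbhs x (U i) by have [oU Ux _] := hU i; exact: open_near.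
  exact: (@filter_forall _ _ U (nbhs x) _ nUi).
have nV : \forall y \near x, V (phi y).
  have cphi : phi @ x --> phi x := differentiable_continuous dphi.
  exact: (cphi V (open_near oV Vx)).
exists ([set y | (forall i, U i y) /\ V (phi y)]^°); split.
- exact: open_interior.
- exact: filterI.
- move=> k; apply: Ck_comp (sV k).
  + exact: open_interior.
  + by move=> y /interior_subset [].
  + move=> i k'; have [_ _ s] := hU i; apply: Ck_subset (s k') => y.
    by move=> /interior_subset [].
Qed.

End EuclideanComposition.

(** * Smooth functions on manifolds *)

Section Charts.
Variables (R : realType) (m : nat).

Section OneChart.
Variables (T : topologicalType) (c : chart R m T) (p : T).
Hypothesis cp : cdom c p.

Lemma cmap_cvg : cmap c @ p --> cmap c p.
Proof.
have := @cmap_cont _ _ _ c; rewrite continuous_open_subspace; last exact: cdom_open.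
by apply; rewrite inE.
Qed.

Lemma cinv_cvg : cinv c @ cmap c p --> p.
Proof.
have := @cinv_cont _ _ _ c; rewrite continuous_open_subspace; last exact: (@cimg_open _ _ _ c).
move=> /(_ (cmap c p)); rewrite /prop_for /continuous_at cmapK //.
by apply; rewrite inE; exists p.
Qed.

Lemma near_cmap (P : set 'rV[R]_m) :
  nbhs (cmap c p) P -> \forall q \near p, P (cmap c q).
Proof. exact: cmap_cvg. Qed.

Lemma near_cinv (P : set T) :
  nbhs p P -> \forall x \near cmap c p, P (cinv c x).
Proof. exact: cinv_cvg. Qed.

Lemma near_cdom : \forall q \near p, cdom c q.
Proof. exact: open_near (cdom_open c) cp. Qed.

Lemma near_cinvK : \forall x \near cmap c p, cmap c (cinv c x) = x.
Proof.
have : nbhs (cmap c p) (cmap c @` cdom c).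
  by apply: (open_near (@cimg_open _ _ _ c)); exists p.
by apply: filterS => x [q cq <-]; rewrite cmapK.
Qed.

End OneChart.

Variable M : manifold R m.
Implicit Types (p q : M) (f g : M -> R) (c : chart R m M).

Lemma chart_at_atlas p : atlas (chart_at p).
Proof. by rewrite /chart_at; case: cid => c []. Qed.

Lemma chart_atP p : cdom (chart_at p) p.
Proof. by rewrite /chart_at; case: cid => c []. Qed.

Lemma transition_smooth c c' p i : atlas c -> atlas c' -> cdom c p ->
  cdom c' p -> smooth_near (fun x => cmap c' (cinv c x) ord0 i) (cmap c p).
Proof.
move=> ac ac' cp cp'; have s := atlas_compatible ac ac' i.
(* Near the image of [p] every point comes from the overlap, since both domains are open and
   [cinv c] is continuous there. *)
have nU : nbhs (cmap c p) (cmap c @` (cdom c `&` cdom c')).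
  near=> x; exists (cinv c x).
    by split; near: x; exact: near_cinv (near_cdom _).
  by near: x; exact: near_cinvK.
exists ((cmap c @` (cdom c `&` cdom c'))^°); split=> //.
  exact: open_interior.
by move=> k; apply: Ck_subset (s k); exact: interior_subset.
Unshelve. all: by end_near. Qed.

Lemma smooth_in_chart f p c c' : atlas c -> atlas c' -> cdom c p ->
  cdom c' p -> smooth_near (f \o cinv c) (cmap c p) ->
  smooth_near (f \o cinv c') (cmap c' p).
Proof.
move=> ac ac' cp cp' s.
have phis i := transition_smooth i ac' ac cp' cp.
have s' : smooth_near (f \o cinv c) (cmap c (cinv c' (cmap c' p))).
  by rewrite cmapK.
apply: smooth_near_eq (smooth_near_comp phis s').
near=> x => /=; rewrite cmapK //; near: x.
exact: near_cinv (near_cdom _).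
Unshelve. all: by end_near. Qed.

(** The chart in [smooth_at] changes with the point, so comparing nearby points requires a fixed
    one; smooth transition maps make the choice immaterial. *)
Lemma smooth_atP f p c : atlas c -> cdom c p ->
  smooth_at f p <-> smooth_near (f \o cinv c) (cmap c p).
Proof.
move=> ac cp; split; apply: smooth_in_chart => //;
  by [exact: chart_at_atlas|exact: chart_atP].
Qed.

Lemma smooth_at_near f p : smooth_at f p -> \forall q \near p, smooth_at f q.
Proof.
move=> s; have cp := chart_atP p; have ac := chart_at_atlas p.
near=> q; have cq : cdom (chart_at p) q by near: q; exact: near_cdom.
apply/(smooth_atP _ ac cq); near: q.
exact: (near_cmap cp (smooth_near_nbhs s)).
Unshelve. all: by end_near. Qed.

Lemma smooth_at_eq f g p : (\forall q \near p, f q = g q) ->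
  smooth_at f p -> smooth_at g p.
Proof. by move=> fg; apply: smooth_near_eq; exact: near_cinv (chart_atP p) _ fg. Qed.

Lemma smooth_at_continuous f p : smooth_at f p -> f @ p --> f p.
Proof.
move=> /smooth_near_continuous s.
have cf : f \o cinv (chart_at p) @ cmap (chart_at p) p --> f p.
  by move: s; rewrite /prop_for /continuous_at /= cmapK //; exact: chart_atP.
move=> P /cf nP; have := near_cmap (chart_atP p) nP.
apply: filterS2 (near_cdom (chart_atP p)) => q cq /=.
by rewrite /= cmapK.
Qed.

Lemma smooth_at_cst a p : smooth_at (fun=> a) p.
Proof. exact: smooth_near_cst. Qed.

Lemma smooth_atD f g p : smooth_at f p -> smooth_at g p ->
  smooth_at (fun q => f q + g q) p.
Proof. exact: smooth_nearD. Qed.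

Lemma smooth_atM f g p : smooth_at f p -> smooth_at g p ->
  smooth_at (fun q => f q * g q) p.
Proof. exact: smooth_nearM. Qed.

Lemma smooth_atV f p : f p != 0 -> smooth_at f p ->
  smooth_at (fun q => (f q)^-1) p.
Proof. by move=> fp; apply: smooth_nearV; rewrite /= cmapK //; exact: chart_atP. Qed.

Lemma smooth_at_sum (I : Type) (r : seq I) (P : pred I) (F : I -> M -> R) p :
  (forall i, P i -> smooth_at (F i) p) ->
  smooth_at (fun q => \sum_(i <- r | P i) F i q) p.
Proof.
move=> h; rewrite (_ : (fun q => _) = \sum_(i <- r | P i) F i); last first.
  by apply/funext => q; rewrite fct_sumE.
elim/big_ind: _ => [|f g sf sg|i Pi]; [exact: smooth_at_cst| |exact: h].
exact: smooth_atD.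
Qed.

Lemma smooth_at_prod (I : Type) (r : seq I) (P : pred I) (F : I -> M -> R) p :
  (forall i, P i -> smooth_at (F i) p) ->
  smooth_at (fun q => \prod_(i <- r | P i) F i q) p.
Proof.
move=> h; elim: r => [|i r IH].
  by under eq_fun do rewrite big_nil; exact: smooth_at_cst.
under eq_fun do rewrite big_cons; case Pi : (P i) => //.
exact: smooth_atM (h i Pi) IH.
Qed.

End Charts.

Section DirectionalDerivative.
Variables (R : realType) (m : nat) (M : manifold R m).
Implicit Types (p q : M) (f g : M -> R).

Lemma smooth_at_differentiable f p : smooth_at f p ->
  differentiable (f \o cinv (chart_at p)) (cmap (chart_at p) p).
Proof. exact: smooth_near_differentiable. Qed.

Lemma dirder_linear f p (a : R) (u v : tangent p) :
  dirder f (a *: u + v : tangent p) = a * dirder f u + dirder f v.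
Proof. by rewrite /dirder linearP. Qed.

Lemma dirder_sum f p (I : Type) (r : seq I) (a : I -> R) (v : I -> tangent p) :
  dirder f (\sum_(i <- r) a i *: v i : tangent p) =
  \sum_(i <- r) a i * dirder f (v i).
Proof.
rewrite /dirder linear_sum; apply: eq_bigr => i _; by rewrite linearZ.
Qed.

Lemma dirder0 f p : dirder f (0 : tangent p) = 0.
Proof. by rewrite /dirder linear0. Qed.

Lemma dirder_cst a p (v : tangent p) : dirder (fun=> a) v = 0.
Proof. exact: (congr1 (@^~ v) (diff_cst _ _)). Qed.

Lemma dirder_eq f g p (v : tangent p) : (\forall q \near p, f q = g q) ->
  smooth_at f p -> dirder g v = dirder f v.
Proof.
move=> fg s; apply: near_diff_at; last exact: smooth_at_differentiable.
by have := near_cinv (chart_atP p) fg; apply: filterS.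
Qed.

Lemma dirderD f g p (v : tangent p) : smooth_at f p -> smooth_at g p ->
  dirder (fun q => f q + g q) v = dirder f v + dirder g v.
Proof.
by move=> sf sg; apply: diffD_at; exact: smooth_at_differentiable.
Qed.

Lemma dirderM f g p (v : tangent p) : smooth_at f p -> smooth_at g p ->
  dirder (fun q => f q * g q) v = f p * dirder g v + g p * dirder f v.
Proof.
move=> sf sg; have := diffM_at v (smooth_at_differentiable sf)
  (smooth_at_differentiable sg).
by rewrite /= !cmapK //; exact: chart_atP.
Qed.

Lemma dirder_bigsum (I : Type) (r : seq I) (F : I -> M -> R) p
    (v : tangent p) : (forall i, smooth_at (F i) p) ->
  dirder (fun q => \sum_(i <- r) F i q) v = \sum_(i <- r) dirder (F i) v.
Proof.
move=> h; elim: r => [|i r IH].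
  rewrite big_nil -[RHS](dirder_cst 0 v); congr (dirder _ v).
  by apply/funext => q; rewrite big_nil.
rewrite big_cons -IH -dirderD //; last exact: smooth_at_sum.
by congr (dirder _ v); apply/funext => q; rewrite big_cons.
Qed.

(** The derivatives of these functions along a tangent vector at [p] are its components, so they
    serve as test functions for vectors. *)
Definition coord p (i : 'I_m) : M -> R := fun q => cmap (chart_at p) q ord0 i.

Lemma smooth_coord p i : smooth_at (coord p i) p.
Proof.
by apply: transition_smooth; [exact: chart_at_atlas|exact: chart_at_atlas|exact: chart_atP|exact: chart_atP].
Qed.

Lemma dirder_coord p (v : tangent p) i : dirder (coord p i) v = v ord0 i.
Proof.
have h := near_cinvK (chart_atP p).
have h' : \forall x \near cmap (chart_at p) p,
    (x : 'rV[R]_m) ord0 i = (coord p i \o cinv (chart_at p)) x.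
  by apply: filterS h => x; rewrite /coord /= => ->.
rewrite /dirder (near_diff_at v h') //; last exact: differentiable_coord.
exact: diff_coord.
Qed.

End DirectionalDerivative.

(** * Smooth maps, vector fields and coordinate frames *)

Section SmoothMaps.
Variables (R : realType) (m n : nat) (M : manifold R m) (N : manifold R n).
Variable F : M -> N.
Hypothesis sF : smooth_map F.

Lemma smooth_map_cvg p : F @ p --> F p.
Proof. by case: sF => + _; apply. Qed.

Lemma local_rep_smooth p i :
  smooth_near (fun x => cmap (chart_at (F p)) (F (cinv (chart_at p) x)) ord0 i)
    (cmap (chart_at p) p).
Proof. by case: sF => _ h; exact: h. Qed.

(** Continuity of [F] keeps images of points near [p] inside the domain of the chart at [F p], where
    the round trip through the chart is the identity. *)
Lemma near_local_rep p : \forall x \near cmap (chart_at p) p,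
  cinv (chart_at (F p)) (cmap (chart_at (F p)) (F (cinv (chart_at p) x))) =
  F (cinv (chart_at p) x).
Proof.
have h : \forall q \near p, cdom (chart_at (F p)) (F q).
  exact: smooth_map_cvg (near_cdom (chart_atP (F p))).
by apply: filterS (near_cinv (chart_atP p) h) => x; exact: cmapK.
Qed.

Lemma local_repE p : cmap (chart_at (F p))
  (F (cinv (chart_at p) (cmap (chart_at p) p))) = cmap (chart_at (F p)) (F p).
Proof. by rewrite cmapK //; exact: chart_atP. Qed.

Lemma smooth_at_comp f p : smooth_at f (F p) -> smooth_at (f \o F) p.
Proof.
move=> s.
have s' : smooth_near (f \o cinv (chart_at (F p))) (cmap (chart_at (F p))
    (F (cinv (chart_at p) (cmap (chart_at p) p)))) by rewrite local_repE.
apply: smooth_near_eq (smooth_near_comp (local_rep_smooth p) s').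
by apply: filterS (near_local_rep p) => x /= ->.
Qed.

Lemma dirder_differential f p (v : tangent p) : smooth_at f (F p) ->
  dirder f (differential F v) = dirder (f \o F) v.
Proof.
move=> s; rewrite /dirder /differential.
have s' : differentiable (f \o cinv (chart_at (F p))) (cmap (chart_at (F p))
    (F (cinv (chart_at p) (cmap (chart_at p) p)))).
  by rewrite local_repE; exact: smooth_near_differentiable.
have dr : differentiable (cmap (chart_at (F p)) \o F \o cinv (chart_at p))
    (cmap (chart_at p) p).
  apply: differentiable_row => i.
  exact: smooth_near_differentiable (local_rep_smooth p i).
have := diff_comp_at v dr s'; rewrite /= local_repE => <-.
symmetry; apply: near_diff_at; last exact: differentiable_comp.
by apply: filterS (near_local_rep p) => x /= ->.
Qed.

End SmoothMaps.

Section SectionsAlong.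
Variables (R : realType) (m n : nat) (M : manifold R m) (N : manifold R n).
Variable F : M -> N.
Implicit Types (V W : section_along F) (p : M).

Lemma smooth_along_eq V W p : (\forall q \near p, V q = W q) ->
  smooth_along V p -> smooth_along W p.
Proof.
move=> VW sV f /sV; apply: smooth_at_eq.
by apply: filterS VW => q ->.
Qed.

Lemma smooth_along0 p : smooth_along ((fun q => 0) : section_along F) p.
Proof.
move=> f _; apply: smooth_at_eq (smooth_at_cst 0 p).
by near=> q; rewrite dirder0.
Unshelve. all: by end_near. Qed.

Lemma smooth_alongD V W p : smooth_along V p -> smooth_along W p ->
  smooth_along ((fun q => V q + W q) : section_along F) p.
Proof.
move=> sV sW f sf; apply: smooth_at_eq (smooth_atD (sV f sf) (sW f sf)).
near=> q; have := dirder_linear f 1 (V q) (W q).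
by rewrite scale1r mul1r.
Unshelve. all: by end_near. Qed.

Lemma smooth_alongZ (a : M -> R) V p : smooth_at a p -> smooth_along V p ->
  smooth_along ((fun q => a q *: V q) : section_along F) p.
Proof.
move=> sa sV f sf; apply: smooth_at_eq (smooth_atM sa (sV f sf)).
near=> q; have := dirder_linear f (a q) (V q) 0.
by rewrite addr0 dirder0 addr0.
Unshelve. all: by end_near. Qed.

Lemma smooth_alongB V W p : smooth_along V p -> smooth_along W p ->
  smooth_along ((fun q => V q - W q) : section_along F) p.
Proof.
move=> sV sW.
apply: (smooth_along_eq _
  (smooth_alongD sV (smooth_alongZ (smooth_at_cst (-1) p) sW))).
by near=> q; rewrite scaleN1r.
Unshelve. all: by end_near. Qed.

Lemma smooth_along_sum (I : Type) (r : seq I) (V : I -> section_along F) p :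
  (forall i, smooth_along (V i) p) ->
  smooth_along ((fun q => \sum_(i <- r) V i q) : section_along F) p.
Proof.
move=> h; elim: r => [|i r IH].
  refine (@smooth_along_eq _ _ p _ (@smooth_along0 p)).
  by near=> q; rewrite big_nil.
apply: (smooth_along_eq _ (smooth_alongD (h i) IH)).
by near=> q; rewrite big_cons.
Unshelve. all: by end_near. Qed.

Lemma smooth_along_comp (V : vfield N) p : smooth_map F ->
  smooth_field V (F p) ->
  smooth_along ((fun q => V (F q)) : section_along F) p.
Proof. by move=> sF sV f sf; exact: (smooth_at_comp sF (sV f sf)). Qed.

(** As a derivation, F_*X sends [f] to X(f o F) at all points near [p]; this avoids the local
    representatives of [F], whose charts vary with the point. *)
Lemma smooth_along_push (X : vfield M) p : smooth_map F ->
  smooth_field X p -> smooth_along (push F X) p.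
Proof.
move=> sF sX f sf; have h : \forall q \near p, smooth_at f (F q).
  exact: (smooth_map_cvg sF (smooth_at_near sf)).
apply: smooth_at_eq (sX _ (smooth_at_comp sF sf)).
by apply: filterS h => q sfq; rewrite /push (dirder_differential sF).
Qed.

End SectionsAlong.

Section CoordinateFrame.
Variables (R : realType) (m : nat) (M : manifold R m).
Implicit Types (p q b : M) (f : M -> R).

Lemma tangent_ext p (u v : tangent p) :
  (forall f, smooth_at f p -> dirder f u = dirder f v) -> u = v.
Proof.
move=> h; apply/rowP => i.
have := h _ (smooth_coord p i).
by rewrite !dirder_coord.
Qed.

(* The i-th coordinate field of the chart at b; its value at q is expressed,
   like every tangent vector at q, in the chart at q. Junk outside the domain
   of the chart at b. *)
Definition frame b (i : 'I_m) : vfield M := fun q =>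
  'd (cmap (chart_at q) \o cinv (chart_at b)) (cmap (chart_at b) q)
     (delta_mx ord0 i).

Lemma transition_differentiable p q : cdom (chart_at p) q ->
  differentiable (cmap (chart_at q) \o cinv (chart_at p))
    (cmap (chart_at p) q).
Proof.
move=> pq; apply: differentiable_row => i; apply: smooth_near_differentiable.
apply: transition_smooth pq (chart_atP q); exact: chart_at_atlas.
Qed.

Lemma transition_differentiableV p q : cdom (chart_at p) q ->
  differentiable (cmap (chart_at p) \o cinv (chart_at q))
    (cmap (chart_at q) q).
Proof.
move=> pq; apply: differentiable_row => i; apply: smooth_near_differentiable.
apply: transition_smooth (chart_atP q) pq; exact: chart_at_atlas.
Qed.

Lemma dirder_frame f b i q : cdom (chart_at b) q -> smooth_at f q ->
  dirder f (frame b i q) =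
  'd (f \o cinv (chart_at b)) (cmap (chart_at b) q) (delta_mx ord0 i).
Proof.
move=> bq s.
have E : (cmap (chart_at q) \o cinv (chart_at b)) (cmap (chart_at b) q) =
    cmap (chart_at q) q by exact: (congr1 _ (cmapK bq)).
have dt := transition_differentiable bq.
have s' : differentiable (f \o cinv (chart_at q))
    ((cmap (chart_at q) \o cinv (chart_at b)) (cmap (chart_at b) q)).
  by rewrite E; exact: smooth_near_differentiable.
transitivity ('d ((f \o cinv (chart_at q)) \o
    (cmap (chart_at q) \o cinv (chart_at b))) (cmap (chart_at b) q)
    (delta_mx ord0 i)).
  by rewrite (diff_comp_at _ dt s') E.
have : \forall x \near cmap (chart_at b) q,
    cdom (chart_at q) (cinv (chart_at b) x).
  exact: (near_cinv bq (near_cdom (chart_atP q))).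
move=> nq; symmetry; apply: near_diff_at.
  by apply: filterS nq => x xq /=; rewrite cmapK.
exact: (differentiable_comp dt s').
Qed.

Lemma smooth_frame b i : smooth_field (frame b i) b.
Proof.
move=> f sf; have cb := chart_atP b.
apply: (@smooth_at_eq _ _ _ (fun q =>
  'd (f \o cinv (chart_at b)) (cmap (chart_at b) q) (delta_mx ord0 i))).
  apply: filterS2 (near_cdom cb) (smooth_at_near sf) => q bq sq.
  by rewrite dirder_frame.
apply: smooth_near_eq (smooth_near_diff (delta_mx ord0 i) sf).
by apply: filterS (near_cinvK cb) => x /= ->.
Qed.

Lemma near_smooth_coord b :
  \forall q \near b, forall i, smooth_at (coord b i) q.
Proof.
have h i := smooth_at_near (smooth_coord b i).
exact: (@filter_forall _ _ (fun i q => smooth_at (coord b i) q) (nbhs b) _ h).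
Qed.

(** Chain rule through the transition map from the chart at [q] to the chart at [b]: its
    differential sends [w] to the vector of derivatives of the coordinates of [b] along [w]. *)
Lemma dirder_expand f b q (w : tangent q) : cdom (chart_at b) q ->
  smooth_at f q ->
  dirder f w = \sum_i dirder (coord b i) w * dirder f (frame b i q).
Proof.
move=> bq s.
have E : (cmap (chart_at b) \o cinv (chart_at q)) (cmap (chart_at q) q) =
    cmap (chart_at b) q by exact: (congr1 _ (cmapK (chart_atP q))).
have dt := transition_differentiableV bq.
have sb : differentiable (f \o cinv (chart_at b))
    ((cmap (chart_at b) \o cinv (chart_at q)) (cmap (chart_at q) q)).
  rewrite E; apply: smooth_near_differentiable.
  by apply/smooth_atP => //; exact: chart_at_atlas.
have : dirder f w = 'd ((f \o cinv (chart_at b)) \o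
    (cmap (chart_at b) \o cinv (chart_at q))) (cmap (chart_at q) q) w.
  apply: near_diff_at; last exact: (differentiable_comp dt sb).
  have : \forall x \near cmap (chart_at q) q,
      cdom (chart_at b) (cinv (chart_at q) x).
    exact: (near_cinv (chart_atP q) (near_cdom bq)).
  by apply: filterS => x xb /=; rewrite cmapK.
rewrite (diff_comp_at w dt sb) E => ->.
rewrite (row_sum_delta ('d (cmap (chart_at b) \o cinv (chart_at q)) _ w)).
rewrite linear_sum; apply: eq_bigr => i _.
by rewrite linearZ (dirder_frame i bq s) -(diff_row w i dt).
Qed.

Lemma frame_span b q (w : tangent q) : cdom (chart_at b) q ->
  w = \sum_i dirder (coord b i) w *: (frame b i q : tangent q).
Proof.
move=> bq; apply: tangent_ext => f sf.
by rewrite dirder_sum (dirder_expand w bq sf).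
Qed.

Lemma dirder_coord_frame b q i k : cdom (chart_at b) q ->
  dirder (coord b k) (frame b i q : tangent q) = (i == k)%:R.
Proof.
move=> bq; have sq : smooth_at (coord b k) q.
  by apply/(smooth_atP _ (chart_at_atlas b) bq);
     apply: transition_smooth => //; exact: chart_at_atlas.
rewrite (dirder_frame _ bq sq).
have h' : \forall x \near cmap (chart_at b) q,
    (x : 'rV[R]_m) ord0 k = (coord b k \o cinv (chart_at b)) x.
  by apply: filterS (near_cinvK bq) => x; rewrite /coord /= => ->.
rewrite (near_diff_at _ h') //; last exact: differentiable_coord.
by rewrite diff_coord mxE eqxx eq_sym.
Qed.

End CoordinateFrame.

(** * Gram matrices, orthogonal projections and gradients *)

Section InnerProduct.
Variables (R : realType) (m : nat) (M : manifold R m) (g : metric M).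
Implicit Types (p q : M).

Lemma inner0l p (w : tangent p) : g p 0 w = 0.
Proof.
have := inner_linear g (-1) 0 0 w.
by rewrite scaler0 addr0 mulN1r addNr.
Qed.

Lemma innerDl p (u v w : tangent p) : g p (u + v) w = g p u w + g p v w.
Proof. by rewrite -[u in LHS]scale1r inner_linear mul1r. Qed.

Lemma innerZl p a (u w : tangent p) : g p (a *: u) w = a * g p u w.
Proof. by rewrite -[a *: u]addr0 inner_linear inner0l addr0. Qed.

Lemma innerNl p (u w : tangent p) : g p (- u) w = - g p u w.
Proof. by rewrite -scaleN1r innerZl mulN1r. Qed.

Lemma innerBl p (u v w : tangent p) : g p (u - v) w = g p u w - g p v w.
Proof. by rewrite innerDl innerNl. Qed.

Lemma inner_suml p (I : Type) (r : seq I) (v : I -> tangent p) (w : tangent p) :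
  g p (\sum_(i <- r) v i) w = \sum_(i <- r) g p (v i) w.
Proof.
elim: r => [|i r IH]; first by rewrite !big_nil inner0l.
by rewrite !big_cons innerDl IH.
Qed.

Lemma innerDr p (u v w : tangent p) : g p w (u + v) = g p w u + g p w v.
Proof. by rewrite inner_sym innerDl !(inner_sym g w). Qed.

Lemma innerZr p a (u w : tangent p) : g p w (a *: u) = a * g p w u.
Proof. by rewrite inner_sym innerZl (inner_sym g w). Qed.

Lemma innerNr p (u w : tangent p) : g p w (- u) = - g p w u.
Proof. by rewrite inner_sym innerNl (inner_sym g w). Qed.

Lemma innerBr p (u v w : tangent p) : g p w (u - v) = g p w u - g p w v.
Proof. by rewrite innerDr innerNr. Qed.

Lemma inner_sumr p (I : Type) (r : seq I) (v : I -> tangent p) (w : tangent p) :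
  g p w (\sum_(i <- r) v i) = \sum_(i <- r) g p w (v i).
Proof.
by rewrite inner_sym inner_suml; apply: eq_bigr => i _; rewrite inner_sym.
Qed.

Lemma inner_eq0 p (v : tangent p) : g p v v = 0 -> v = 0.
Proof.
move=> gv; apply/eqP/negPn/negP => /(inner_pos g).
by rewrite gv ltxx.
Qed.

Lemma inner_ext p (u v : tangent p) :
  (forall w, g p u w = g p v w) -> u = v.
Proof.
move=> h; apply: subr0_eq; apply: (@inner_eq0 p).
by rewrite innerBl h subrr.
Qed.

End InnerProduct.

Section Gram.
Variables (R : realType) (m : nat) (M : manifold R m) (g : metric M).
Implicit Types (p q : M).

Definition independent r (E : 'I_r -> vfield M) q : Prop :=
  forall c : 'I_r -> R, \sum_i c i *: (E i q : tangent q) = 0 ->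
    forall i, c i = 0.

Lemma smooth_at_det r (A : M -> 'M[R]_r) p :
  (forall i j, smooth_at (fun q => A q i j) p) ->
  smooth_at (fun q => \det (A q)) p.
Proof.
move=> h; rewrite /determinant; apply: smooth_at_sum => s _.
apply: smooth_atM; first exact: smooth_at_cst.
by apply: smooth_at_prod => i _; exact: h.
Qed.

(** By Cramer's rule the inverse is the adjugate divided by the determinant, and the determinant
    stays nonzero near [p] by continuity. *)
Lemma smooth_at_invmx r (A : M -> 'M[R]_r) p i j :
  (forall i j, smooth_at (fun q => A q i j) p) -> A p \in unitmx ->
  smooth_at (fun q => invmx (A q) i j) p /\ \forall q \near p, A q \in unitmx.
Proof.
move=> h up; have sd := smooth_at_det h.
have d0 : \det (A p) != 0 by rewrite -unitfE -unitmxE.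
have nu : \forall q \near p, A q \in unitmx.
  have n0 : \forall q \near p, \det (A q) != 0.
    exact: (cvgr_neq0 _ (smooth_at_continuous sd) d0).
  by apply: filterS n0 => q; rewrite unitmxE unitfE.
split=> //.
apply: (@smooth_at_eq _ _ _ (fun q => (\det (A q))^-1 * \adj (A q) i j)).
  by apply: filterS nu => q uq; rewrite /invmx uq !mxE.
apply: smooth_atM; first exact: smooth_atV.
rewrite /adjugate; under eq_fun do rewrite mxE /cofactor.
apply: smooth_atM; first exact: smooth_at_cst.
apply: smooth_at_det => k l; under eq_fun do rewrite !mxE.
exact: h.
Qed.

Section OneFamily.
Variables (r : nat) (E : 'I_r -> vfield M).

Definition gram q : 'M[R]_r :=
  \matrix_(i, j) g q (E i q : tangent q) (E j q : tangent q).

(** A row in the kernel of the Gram matrix gives a combination u of the E_i orthogonal to every E_i,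
    hence with g(u,u) = 0. *)
Lemma gram_unit q : independent E q -> gram q \in unitmx.
Proof.
move=> iE; rewrite unitmxE unitfE; apply/negP => /det0P[c c0 cG].
case/negP: c0; apply/eqP/rowP => i; rewrite mxE.
pose u : tangent q := \sum_i c ord0 i *: (E i q : tangent q).
apply: (iE (fun i => c ord0 i)); apply: (@inner_eq0 _ _ _ g q u).
rewrite {2}/u inner_sumr big1 // => j _; rewrite innerZr.
have /rowP/(_ j) := cG; rewrite !mxE => cGj.
rewrite /u inner_suml; suff -> : \sum_i g q (c ord0 i *: (E i q : tangent q)) (E j q) = 0.
  by rewrite mulr0.
by rewrite -[RHS]cGj; apply: eq_bigr => k _; rewrite innerZl mxE.
Qed.

(** Where the Gram matrix is invertible, this is the combination of the E_i whose inner product with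
    each E_j is a_j. It yields orthogonal projections for a_j = g(X, E_j) and gradients for a_j =
    E_j(f). *)
Definition gram_dual (a : 'I_r -> M -> R) : vfield M := fun q =>
  \sum_i (\sum_j a j q * invmx (gram q) j i) *: (E i q : tangent q).

Lemma gram_dualE a q k : gram q \in unitmx ->
  g q (gram_dual a q) (E k q : tangent q) = a k q.
Proof.
move=> u; rewrite inner_suml.
have := congr1 (fun (A : 'M[R]_r) => ((\row_(j < r) a j q) *m A) ord0 k) (mulVmx u).
rewrite mulmx1 mulmxA [RHS]mxE => <-; rewrite mxE.
by apply: eq_bigr => i _; rewrite innerZl !mxE; congr (_ * _);
   apply: eq_bigr => j _; rewrite mxE.
Qed.

Variable p : M.
Hypothesis sE : forall i, smooth_field (E i) p.
Hypothesis iE : independent E p.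

Lemma near_gram_unit : \forall q \near p, gram q \in unitmx.
Proof.
have sG i j : smooth_at (fun q => gram q i j) p.
  by under eq_fun do rewrite mxE; exact: inner_smooth.
(* [smooth_at_invmx] speaks of an entry and so needs an index; the empty family is independent at
   every point. *)
case: (pselect (inhabited 'I_r)) => [[i]|n0].
  by case: (smooth_at_invmx i i sG (gram_unit iE)).
near=> q; apply: gram_unit => c _ i; by case: n0.
Unshelve. all: by end_near. Qed.

Lemma gram_dual_smooth a : (forall j, smooth_at (a j) p) ->
  smooth_field (gram_dual a) p.
Proof.
move=> sa.
have sG i j : smooth_at (fun q => gram q i j) p.
  by under eq_fun do rewrite mxE; exact: inner_smooth.
apply: smooth_along_sum => i; apply: (smooth_alongZ _ (sE i)).
apply: smooth_at_sum => j _; apply: (smooth_atM (sa j)).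
by case: (smooth_at_invmx j i sG (gram_unit iE)).
Qed.

End OneFamily.

(** * Orthogonal projections onto distributions *)

Section Projection.
Variable D : subspaces M.
Arguments D : clear implicits.

Definition is_proj (X : vfield M) p (u : tangent p) : Prop :=
  D p u /\ orth g D (X p - u : tangent p).

(** [D] is only a family of sets here, so [u - v] need not belong to it; but it is orthogonal to all
    of [D p], in particular to [u] and [v]. *)
Lemma is_proj_unique X p (u v : tangent p) : is_proj X u -> is_proj X v -> u = v.
Proof.
move=> [Du [_ ou]] [Dv [_ ov]].
apply: subr0_eq; apply: (@inner_eq0 _ _ _ g p).
have E w : D p w -> g p (u - v) w = 0.
  move=> Dw; have := ou w Dw; have := ov w Dw; rewrite !innerBl => hv hu.
  by rewrite -(subr0_eq hu) -(subr0_eq hv) subrr.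
by rewrite innerBr !E // subrr.
Qed.

Lemma projE X p (u : tangent p) : is_proj X u -> Defs.proj g D X p = u.
Proof.
move=> Xu; apply: (is_proj_unique _ Xu).
by apply: (@xgetPex _ 0 (fun u => is_proj X u)); exists u.
Qed.

Lemma is_proj_gram r (E : 'I_r -> vfield M) X q : gram E q \in unitmx ->
  D q = [set v | exists c : 'I_r -> R,
                       v = \sum_i c i *: (E i q : tangent q)] ->
  is_proj X (gram_dual E (fun j q' => g q' (X q' : tangent q') (E j q' : tangent q')) q : tangent q).
Proof.
move=> u Dq; split; first by rewrite Dq /=; eexists; reflexivity.
split=> // w; rewrite Dq => -[c ->]; rewrite inner_sumr big1 // => i _.
by rewrite innerZr innerBl gram_dualE // subrr mulr0.
Qed.

Hypothesis dD : is_distribution D.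

Lemma projP X p : is_proj X (Defs.proj g D X p).
Proof.
have [r [E [sE nE]]] := dD p; have [iE Dp] := nbhs_singleton nE.
apply: (@xgetPex _ 0 (fun u => is_proj X u)).
by eexists; apply: is_proj_gram Dp; exact: gram_unit.
Qed.

(** Near [p] the projection, defined pointwise by choice, coincides with the Gram formula in one
    smooth local frame of [D]. *)
Lemma proj_smooth X p : smooth_field X p -> smooth_field (Defs.proj g D X) p.
Proof.
move=> sX; have [r [E [sE nE]]] := dD p; have [iE Dp] := nbhs_singleton nE.
have sd : smooth_field (gram_dual E
    (fun j q' => g q' (X q' : tangent q') (E j q' : tangent q'))) p.
  by apply: gram_dual_smooth => // j; exact: inner_smooth.
apply: smooth_along_eq sd.
apply: filterS2 (near_gram_unit sE iE) nE => q uq [_ Dq].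
by symmetry; apply: projE; exact: is_proj_gram.
Qed.

End Projection.

(** Two candidates for the component differ by a vector orthogonal to all of [D p], hence to both
    candidates. This pins down the choice made in [component]. *)
Lemma component_eq (D D' : subspaces M) X p (u : tangent p) :
  (forall v w, D p v -> D' p w -> g p v w = 0) ->
  D p u -> D' p (X p - u : tangent p) -> component D D' X p = u.
Proof.
move=> oD Du D'u.
have [] : D p (component D D' X p) /\ D' p (X p - component D D' X p : tangent p).
  by apply: (@xgetPex _ 0 (fun u => D p u /\ D' p (X p - u))); exists u.
move: (component D D' X p) => v Dv D'v.
apply: subr0_eq; apply: (@inner_eq0 _ _ _ g p).
have E w : D p w -> g p w (v - u) = 0.
  move=> Dw; have := oD _ _ Dw D'u; have := oD _ _ Dw D'v.
  rewrite !innerBr => hv hu.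
  by rewrite -(subr0_eq hu) -(subr0_eq hv) subrr.
by rewrite innerBl !E // subrr.
Qed.

Lemma frame_independent p : independent (frame p) p.
Proof.
move=> c c0 k; have := dirder0 (coord p k) p.
rewrite -c0 dirder_sum (bigD1 k) //= big1 => [|i ik].
  by rewrite dirder_coord_frame ?eqxx ?mulr1 ?addr0 //; exact: chart_atP.
by rewrite dirder_coord_frame ?(negbTE ik) ?mulr0 //; exact: chart_atP.
Qed.

Lemma gradient_gram f p q : cdom (chart_at p) q -> gram (frame p) q \in unitmx ->
  forall v : tangent q,
  g q (gram_dual (frame p) (fun j q' => dirder f (frame p j q')) q) v = dirder f v.
Proof.
move=> pq u v; rewrite [v in RHS](frame_span v pq) [v in LHS](frame_span v pq).
rewrite dirder_sum inner_sumr; apply: eq_bigr => i _.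
by rewrite innerZr gram_dualE.
Qed.

(** The Gram formula in the coordinate frame represents the linear form [dirder f], so the set
    defining [gradient] is inhabited and the default value 0 is not taken by mere absence of a
    candidate. *)
Lemma inner_gradient f p (v : tangent p) : g p (gradient g f p) v = dirder f v.
Proof.
move: v; apply: (@xgetPex _ 0 (fun u : tangent p => forall v, g p u v = dirder f v)).
exists (gram_dual (frame p) (fun j q' => dirder f (frame p j q')) p) => v.
apply: gradient_gram; first exact: chart_atP.
by apply: gram_unit; exact: frame_independent.
Qed.

Lemma gradient_smooth f p : smooth_at f p -> smooth_field (gradient g f) p.
Proof.
move=> sf; have iE := @frame_independent p.
have sE := @smooth_frame _ _ M p.
have sd : smooth_field (gram_dual (frame p)
    (fun j q' => dirder f (frame p j q'))) p.
  by apply: gram_dual_smooth => // j; exact: sE.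
apply: smooth_along_eq sd.
apply: filterS2 (near_gram_unit sE iE) (near_cdom (chart_atP p)) => q uq pq.
by apply: (@inner_ext _ _ _ g) => v; rewrite gradient_gram // inner_gradient.
Qed.

End Gram.

(** * The pullback connection *)

Section Connection.
Variables (R : realType) (m n : nat) (M : manifold R m) (N : manifold R n).
Variables (F : M -> N) (nabla : conn_op F).
Hypothesis hc : is_connection nabla.
Implicit Types (V W : section_along F) (p : M).

Lemma conn0 p (v : tangent p) : nabla v (fun q => 0) = 0.
Proof.
have s0 := @smooth_along0 _ _ _ M N F p.
have := conn_add hc v s0 s0.
have -> : (fun q => (0 : tangent (F q)) + 0) = (fun q => 0) :> section_along F.
  by apply/funext => q; rewrite addr0.
by move=> h; apply: (@addrI _ (nabla v (fun q => 0))); rewrite addr0 -h.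
Qed.

Lemma conn_sum (I : Type) (r : seq I) (V : I -> section_along F) p
    (v : tangent p) : (forall i, smooth_along (V i) p) ->
  nabla v (fun q => \sum_(i <- r) V i q) = \sum_(i <- r) nabla v (V i).
Proof.
move=> h; elim: r => [|i r IH].
  rewrite big_nil -[RHS](conn0 v); congr (nabla _ _).
  by apply/funext => q; rewrite big_nil.
rewrite big_cons -IH -(conn_add hc) //; last exact: smooth_along_sum.
by congr (nabla _ _); apply/funext => q; rewrite big_cons.
Qed.

Lemma conn_vec0 p V : smooth_along V p -> nabla (0 : tangent p) V = 0.
Proof.
move=> sV; have := conn_linear hc (-1) 0 0 sV.
by rewrite scaler0 addr0 scaleN1r addNr.
Qed.

Lemma conn_vec_sum (I : Type) (r : seq I) (a : I -> R) p
    (v : I -> tangent p) V : smooth_along V p ->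
  nabla (\sum_(i <- r) a i *: v i : tangent p) V =
  \sum_(i <- r) a i *: nabla (v i) V.
Proof.
move=> sV; elim: r => [|i r IH]; first by rewrite !big_nil conn_vec0.
by rewrite !big_cons (conn_linear hc) // IH.
Qed.

End Connection.

Section Pullback.
Variables (R : realType) (m n : nat) (M : manifold R m) (N : manifold R n).
Variables (gN : metric N) (nablaN : conn_op (@id N)).
Variables (F : M -> N) (nablaF : conn_op F).
Hypothesis sF : smooth_map F.
Hypothesis hN : is_levi_civita gN nablaN.
Hypothesis hP : is_pullback_connection nablaN nablaF.
Variable p : M.

Let hcF : is_connection nablaF := hP.1.
Let hcN : is_connection nablaN := lc_connection hN.

Definition frame_along i : section_along F := fun q => frame (F p) i (F q).

Lemma smooth_frame_along i : smooth_along (frame_along i) p.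
Proof. exact: (smooth_along_comp sF (@smooth_frame _ _ N (F p) i)). Qed.

Lemma near_frame_along (V : section_along F) : \forall q \near p,
  V q = \sum_i dirder (coord (F p) i) (V q) *: frame_along i q.
Proof.
have h : \forall q \near p, cdom (chart_at (F p)) (F q).
  exact: (smooth_map_cvg sF (near_cdom (chart_atP (F p)))).
by apply: filterS h => q hq; exact: frame_span.
Qed.

Lemma smooth_along_coef (V : section_along F) i : smooth_along V p ->
  smooth_at (fun q => dirder (coord (F p) i) (V q)) p.
Proof. by move=> sV; apply: sV; exact: smooth_coord. Qed.

Lemma pullback_frame (v : tangent p) i :
  nablaF v (frame_along i) = nablaN (differential F v) (frame (F p) i).
Proof. by apply: hP.2; exact: smooth_frame. Qed.

(** Locality and the Leibniz rule reduce [nablaF] to the pulled-back coordinate frame, on which it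
    is given by [nablaN]. *)
Lemma pullback_expand (v : tangent p) (V : section_along F) :
  smooth_along V p ->
  nablaF v V = \sum_i (dirder (fun q => dirder (coord (F p) i) (V q)) v
                         *: frame_along i p
                       + dirder (coord (F p) i) (V p)
                         *: nablaN (differential F v) (frame (F p) i)).
Proof.
move=> sV; rewrite (conn_local hcF v sV (near_frame_along V)).
rewrite (conn_sum hcF) => [|i].
  apply: eq_bigr => i _; rewrite (conn_leibniz hcF).
  - by rewrite pullback_frame.
  - exact: smooth_along_coef.
  - exact: smooth_frame_along.
by apply: smooth_alongZ; [exact: smooth_along_coef|exact: smooth_frame_along].
Qed.

(* The torsion identity need only be tested on the coordinate functions, whose
   derivatives along the frame are constant: no symmetry of second
   derivatives is involved. *)
Lemma levi_civita_frame i j :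
  nablaN (frame (F p) i (F p)) (frame (F p) j) =
  nablaN (frame (F p) j (F p)) (frame (F p) i).
Proof.
pose b := F p; apply: subr0_eq; apply/rowP => k.
have sf := @smooth_frame _ _ N b.
have tor := lc_torsion hN (sf i) (sf j) (smooth_coord b k).
have cst i' j' : dirder (fun q => dirder (coord b k) (frame b i' q : tangent q))
    (frame b j' b : tangent b) = 0.
  rewrite -(dirder_cst (i' == k)%:R (frame b j' b : tangent b)).
  apply: dirder_eq; last exact: smooth_at_cst.
  by apply: filterS (near_cdom (chart_atP b)) => q bq; rewrite dirder_coord_frame.
move: tor; rewrite !cst subrr dirder_coord => tor.
by rewrite [RHS]mxE.
Qed.

(* Includes smoothness of the inner product, which [inner_smooth] gives only
   for fields on N and not for sections along F. *)
Definition metric_compatible (V W : section_along F) : Prop :=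
  smooth_at (fun q => gN (F q) (V q) (W q)) p /\
  forall v : tangent p, dirder (fun q => gN (F q) (V q) (W q)) v =
    gN (F p) (nablaF v V) (W p) + gN (F p) (V p) (nablaF v W).

Lemma metric_compatible_sym V W :
  metric_compatible V W -> metric_compatible W V.
Proof.
have E V' W' : (fun q => gN (F q) (V' q) (W' q)) =
    (fun q => gN (F q) (W' q) (V' q)).
  by apply/funext => q; rewrite inner_sym.
case=> s h; split=> [|v]; rewrite E // h addrC.
by congr (_ + _); rewrite inner_sym.
Qed.

Lemma metric_compatible_eq V V' W : smooth_along V p ->
  (\forall q \near p, V q = V' q) ->
  metric_compatible V W -> metric_compatible V' W.
Proof.
move=> sV VV [s h].
have E : \forall q \near p, gN (F q) (V q) (W q) = gN (F q) (V' q) (W q).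
  by apply: filterS VV => q ->.
split=> [|v]; first exact: smooth_at_eq E s.
by rewrite (dirder_eq v E s) h (conn_local hcF v sV VV) (nbhs_singleton VV).
Qed.

Lemma metric_compatibleZ a V W : smooth_at a p -> smooth_along V p ->
  metric_compatible V W -> metric_compatible (fun q => a q *: V q) W.
Proof.
move=> sa sV [s h].
have E : (fun q => gN (F q) (a q *: V q) (W q)) =
    (fun q => a q * gN (F q) (V q) (W q)).
  by apply/funext => q; rewrite innerZl.
split=> [|v]; rewrite E; first exact: smooth_atM.
rewrite dirderM // h (conn_leibniz hcF) // innerDl !innerZl.
ring.
Qed.

Lemma metric_compatible_sum (I : Type) (r : seq I) (V : I -> section_along F) W :
  (forall i, smooth_along (V i) p) -> (forall i, metric_compatible (V i) W) ->
  metric_compatible (fun q => \sum_(i <- r) V i q) W.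
Proof.
move=> sV h.
have E : (fun q => gN (F q) (\sum_(i <- r) V i q) (W q)) =
    (fun q => \sum_(i <- r) gN (F q) (V i q) (W q)).
  by apply/funext => q; rewrite inner_suml.
split=> [|v]; rewrite E.
  by apply: smooth_at_sum => i _; case: (h i).
rewrite dirder_bigsum => [|i]; last by case: (h i).
rewrite (conn_sum hcF) // !inner_suml -big_split /=.
by apply: eq_bigr => i _; case: (h i) => _ ->.
Qed.

Lemma metric_compatible_expand (V W : section_along F) : smooth_along V p ->
  (forall i, metric_compatible (frame_along i) W) -> metric_compatible V W.
Proof.
move=> sV h; have sZ i := smooth_alongZ (smooth_along_coef i sV)
  (smooth_frame_along i).
apply: (@metric_compatible_eq _ V W (smooth_along_sum (index_enum _) sZ)).
  by apply: filterS (near_frame_along V) => q /esym.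
apply: metric_compatible_sum => // i.
apply: metric_compatibleZ => //.
- exact: smooth_along_coef.
- exact: smooth_frame_along.
Qed.

(** Both arguments are reduced in turn to the pulled-back frame, where the claim is metricity of
    [nablaN] composed with [F]. *)
Lemma pullback_metric (V W : section_along F) :
  smooth_along V p -> smooth_along W p -> metric_compatible V W.
Proof.
move=> sV sW; apply: metric_compatible_expand => // i.
apply/metric_compatible_sym/metric_compatible_expand => // j.
have sf := @smooth_frame _ _ N (F p).
have sg := inner_smooth gN (sf j) (sf i).
split=> [|v]; first exact: (smooth_at_comp sF sg).
rewrite !pullback_frame -(lc_metric hN) //.
by rewrite (dirder_differential sF).
Qed.

(** With y_i the coordinates at [F p], the frame coefficients of the left-hand side are X(Y(y_i o
    F)) - Y(X(y_i o F)) once the Christoffel terms cancel; torsion-freeness of [nablaM] on y_i o F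
    then gives the right-hand side. *)
Lemma pullback_torsion (gM : metric M) (nablaM : conn_op (@id M))
    (X Y : vfield M) : is_levi_civita gM nablaM ->
  smooth_field X p -> smooth_field Y p ->
  nablaF (X p : tangent p) (push F Y) - nablaF (Y p : tangent p) (push F X) =
  differential F (nablaM p (X p) Y - nablaM p (Y p) X : tangent p).
Proof.
move=> hM sX sY; pose b := F p.
have sc i := smooth_at_comp sF (smooth_coord b i).
have nc : \forall q \near p, forall i, smooth_at (coord b i) (F q).
  exact: (smooth_map_cvg sF (near_smooth_coord b)).
have co (Z : vfield M) (v : tangent p) i : smooth_field Z p ->
    dirder (fun q => dirder (coord b i) (push F Z q)) v =
    dirder (fun q => dirder (coord b i \o F) (Z q : tangent q)) v.
  move=> sZ; apply: dirder_eq; last by apply: sZ; exact: sc.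
  by apply: filterS nc => q h; rewrite /push dirder_differential.
have sx := smooth_along_push sF sX; have sy := smooth_along_push sF sY.
rewrite (pullback_expand _ sx) (pullback_expand _ sy).
rewrite [RHS](frame_span _ (chart_atP b)) !big_split /=.
have sf := @smooth_frame _ _ N b.
(* The Christoffel terms are bilinear in F_*X and F_*Y, and symmetric by [levi_civita_frame]. *)
have mixed : \sum_i dirder (coord b i) (push F Y p) *:
      nablaN (differential F (X p : tangent p)) (frame b i) =
    \sum_i dirder (coord b i) (push F X p) *:
      nablaN (differential F (Y p : tangent p)) (frame b i).
  have ex (w : tangent b) i : nablaN w (frame b i) =
      \sum_j dirder (coord b j) w *: nablaN (frame b j b : tangent b) (frame b i).
    rewrite -(conn_vec_sum hcN); last exact: sf.
    exact: (congr1 (fun u => nablaN u (frame b i)) (frame_span w (chart_atP b))).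
  under eq_bigr => i _ do rewrite ex scaler_sumr.
  under [RHS]eq_bigr => i _ do rewrite ex scaler_sumr.
  rewrite exchange_big; apply: eq_bigr => i _; apply: eq_bigr => j _.
  by rewrite !scalerA levi_civita_frame mulrC.
rewrite mixed [X in _ - X]addrC addrKA -sumrB; apply: eq_bigr => i _.
rewrite -scalerBl !co // -(lc_torsion hM sX sY (sc i)).
by rewrite dirder_differential //; exact: smooth_coord.
Qed.

End Pullback.

(** * Horizontally conformal submersions *)

Section HorizontalDistribution.
Variables (R : realType) (m n : nat) (M : manifold R m) (N : manifold R n).
Variables (gM : metric M) (F : M -> N).
Hypothesis hF : is_submersion F.

Let sF : smooth_map F := hF.1.

Lemma vert0 p : vert F (0 : tangent p).
Proof. by rewrite /vert /differential /= linear0. Qed.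

Lemma vertB p (u v : tangent p) : vert F u -> vert F v -> vert F (u - v : tangent p).
Proof. by rewrite /vert /differential /= linearB /= => -> ->; rewrite subrr. Qed.

Lemma vertD p (u v : tangent p) : vert F u -> vert F v -> vert F (u + v : tangent p).
Proof. by rewrite /vert /differential /= linearD /= => -> ->; rewrite addr0. Qed.

Lemma horizB p (u v : tangent p) :
  horiz gM F u -> horiz gM F v -> horiz gM F (u - v : tangent p).
Proof.
by move=> [_ hu] [_ hv]; split=> // w vw; rewrite innerBl hu // hv // subrr.
Qed.

Lemma horizD p (u v : tangent p) :
  horiz gM F u -> horiz gM F v -> horiz gM F (u + v : tangent p).
Proof.
by move=> [_ hu] [_ hv]; split=> // w vw; rewrite innerDl hu // hv // addr0.
Qed.

(** Gradients of the components of [F] in the chart at [F p]. Near [p], a vector is vertical exactly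
    when it is orthogonal to all of them, so they span the horizontal spaces. *)
Definition horizontal_frame p i : vfield M := gradient gM (coord (F p) i \o F).

Lemma horizontal_frame_smooth p i : smooth_field (horizontal_frame p i) p.
Proof.
by apply: gradient_smooth; apply: (smooth_at_comp sF); exact: smooth_coord.
Qed.

Definition adapted p q : Prop :=
  cdom (chart_at (F p)) (F q) /\ forall i, smooth_at (coord (F p) i) (F q).

Lemma near_adapted p : \forall q \near p, adapted p q.
Proof.
apply: filterI.
  exact: (smooth_map_cvg sF (near_cdom (chart_atP (F p)))).
exact: (smooth_map_cvg sF (near_smooth_coord (F p))).
Qed.

Lemma inner_horizontal_frame p q i (v : tangent q) : adapted p q ->
  gM q (horizontal_frame p i q) v = dirder (coord (F p) i) (differential F v).
Proof.
by move=> [_ sq]; rewrite inner_gradient (dirder_differential sF).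
Qed.

Lemma vertP p q (v : tangent q) : adapted p q ->
  vert F v <-> forall i, gM q (horizontal_frame p i q) v = 0.
Proof.
move=> gq; split=> [vv i|h].
  by rewrite inner_horizontal_frame // vv dirder0.
rewrite /vert /= [LHS](frame_span _ gq.1) big1 // => i _.
by rewrite -inner_horizontal_frame // h scale0r.
Qed.

(** Surjectivity of the differential provides a lift of the k-th coordinate vector; pairing it with
    a vanishing combination isolates the k-th coefficient. *)
Lemma horizontal_frame_independent p q : adapted p q ->
  independent (horizontal_frame p) q.
Proof.
move=> gq c c0 k.
have [v dv] := hF.2 q (frame (F p) k (F q)).
have := inner0l gM v; rewrite -c0 inner_suml => h.
rewrite -h (bigD1 k) //= big1 => [|i ik];
  rewrite innerZl inner_horizontal_frame // dv dirder_coord_frame; try exact: gq.1.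
  by rewrite eqxx mulr1 addr0.
by rewrite eq_sym (negbTE ik) mulr0.
Qed.

(** A horizontal vector minus its Gram projection on the frame is both horizontal and vertical,
    hence zero. *)
Lemma horizE p q : adapted p q ->
  horiz gM F (p := q) = [set v | exists c : 'I_n -> R,
     v = \sum_i c i *: (horizontal_frame p i q : tangent q)].
Proof.
move=> gq; apply/seteqP; split=> v /=.
  move=> hv; set E := horizontal_frame p.
  have uE : gram gM E q \in unitmx.
    by apply: gram_unit; exact: horizontal_frame_independent.
  (* [gram_dual] expects functions as coefficients; constant ones do, since only the point [q]
     matters. *)
  pose a j (q' : M) : R := gM q v (E j q : tangent q).
  pose u : tangent q := gram_dual gM E a q.
  have hu : horiz gM F u.
    split=> // w vw; rewrite inner_suml big1 // => i _.
    by rewrite innerZl (vertP w gq).1 // mulr0.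
  have vu : vert F (v - u : tangent q).
    apply/(vertP _ gq) => i; rewrite inner_sym innerBl gram_dualE //.
    by rewrite subrr.
  have E0 : v - u = 0.
    apply: (@inner_eq0 _ _ _ gM q).
    by case: (horizB hv hu) => _ /(_ _ vu).
  exists (fun i => \sum_j a j q * invmx (gram gM E q) j i).
  exact: (subr0_eq E0).
move=> [c ->]; split=> // w vw; rewrite inner_suml big1 // => i _.
by rewrite innerZl (vertP w gq).1 // mulr0.
Qed.

Lemma horiz_distribution : is_distribution (horiz gM F).
Proof.
move=> p; exists n, (horizontal_frame p); split.
  by move=> i; exact: horizontal_frame_smooth.
apply: filterS (near_adapted p) => q gq; split; last exact: horizE.
exact: horizontal_frame_independent.
Qed.

Lemma orth_horiz_vert p (w : tangent p) :
  (forall u, horiz gM F u -> gM p w u = 0) -> vert F w.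
Proof.
move=> h; have gp := nbhs_singleton (near_adapted p).
apply/(vertP _ gp) => i; rewrite inner_sym; apply: h.
by split=> // v vv; rewrite (vertP v gp).1.
Qed.

Lemma hprojE X p (u : tangent p) : horiz gM F u ->
  vert F (X p - u : tangent p) -> hproj gM F X p = u.
Proof.
move=> hu vu; apply: projE; split=> //; split=> // w [_ hw].
by rewrite inner_sym hw.
Qed.

Lemma vprojE X p (u : tangent p) : vert F u ->
  horiz gM F (X p - u : tangent p) -> vproj gM F X p = u.
Proof. by move=> vu hu; apply: projE. Qed.

Lemma hprojP X p : horiz gM F (hproj gM F X p : tangent p) /\
  vert F (X p - hproj gM F X p : tangent p).
Proof.
have [h [_ o]] := projP gM horiz_distribution X p.
by split=> //; apply: orth_horiz_vert.
Qed.

(** Local frames were built for the horizontal spaces, so the existence of vertical parts is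
    obtained from the complementary projection. *)
Lemma vproj_hproj X p : vproj gM F X p = X p - hproj gM F X p.
Proof.
have [h v] := hprojP X p; apply: vprojE => //.
by rewrite opprB addrC subrK.
Qed.

Lemma vprojP X p : vert F (vproj gM F X p : tangent p) /\
  horiz gM F (X p - vproj gM F X p : tangent p).
Proof.
have [h v] := hprojP X p; rewrite vproj_hproj; split=> //.
by rewrite opprB addrC subrK.
Qed.

Lemma hproj_smooth X p : smooth_field X p -> smooth_field (hproj gM F X) p.
Proof. exact: (proj_smooth gM horiz_distribution). Qed.

End HorizontalDistribution.

(** * The second fundamental form of a horizontally conformal submersion *)

Section ConformalSubmersion.
Variables (R : realType) (m n : nat) (M : manifold R m) (N : manifold R n).
Variables (gM : metric M) (gN : metric N).
Variables (nablaM : conn_op (@id M)) (nablaN : conn_op (@id N)).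
Variables (F : M -> N) (nablaF : conn_op F) (lam : M -> R).
Hypothesis hsub : is_submersion F.
Hypothesis hM : is_levi_civita gM nablaM.
Hypothesis hN : is_levi_civita gN nablaN.
Hypothesis hP : is_pullback_connection nablaN nablaF.
Hypothesis hlam : is_horizontally_conformal gM gN F lam.

Let sF : smooth_map F := hsub.1.

Lemma differentialB p (u v : tangent p) :
  differential F (u - v : tangent p) = differential F u - differential F v.
Proof. exact: linearB. Qed.

(** The vertical part of [u] contributes to neither side, so [u] may be replaced by its horizontal
    part. *)
Lemma conformal_inner p (u v : tangent p) : horiz gM F v ->
  lam p ^+ 2 * gM p u v = gN (F p) (differential F u) (differential F v).
Proof.
move=> hv; have [hu vu] := hprojP gM hsub (fun=> u) p.
set w := hproj _ _ _ _ in hu vu.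
have -> : gM p u v = gM p w v.
  by apply: subr0_eq; rewrite -innerBl inner_sym; case: hv => _; apply.
have -> : differential F u = differential F w.
  by apply: subr0_eq; move: vu; rewrite /vert /differential /= linearB.
exact: hlam.2.
Qed.

(* Nothing is assumed about the regularity of [lam]; it is recovered from
   [lam ^+ 2 = gN (F_* E) (F_* E) / gM E E] for a nonvanishing horizontal E. *)
Lemma dilation_smooth p (v : tangent p) : horiz gM F v -> v != 0 ->
  smooth_at (fun q => lam q ^+ 2) p.
Proof.
move=> hv v0; have [r [E [sE nE]]] := horiz_distribution gM hsub p.
(* A nonzero horizontal vector forces the local frame to be nonempty. *)
have [i0 i0E] : exists i : 'I_r, True.
  have [_ Dp] := nbhs_singleton nE.
  move: hv; rewrite Dp => -[c vE]; apply: contrapT => n0.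
  case/negP: v0; rewrite vE big1 // => i _.
  by case: n0; exists i.
have [+ _] := pullback_metric sF hN hP (smooth_along_push sF (sE i0))
                (smooth_along_push sF (sE i0)).
move=> sN; have sM := inner_smooth gM (sE i0) (sE i0).
have nz : \forall q \near p, gM q (E i0 q : tangent q) (E i0 q) != 0.
  apply: filterS nE => q [iE _]; apply/eqP => /inner_eq0 E0.
  have := iE (fun i => (i == i0)%:R); rewrite (bigD1 i0) //= E0 scaler0.
  rewrite big1 ?addr0 => [|i /negbTE ->]; last by rewrite scale0r.
  by move=> /(_ erefl i0) /eqP; rewrite eqxx oner_eq0.
apply: smooth_at_eq (smooth_atM sN (smooth_atV (nbhs_singleton nz) sM)).
apply: filterS2 nz nE => q nzq [iE Dq].
have hE : horiz gM F (E i0 q : tangent q).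
  rewrite Dq; exists (fun i => (i == i0)%:R); rewrite (bigD1 i0) //= eqxx scale1r.
  by rewrite big1 ?addr0 // => i /negbTE ->; rewrite scale0r.
by rewrite /push -conformal_inner // mulfK.
Qed.

(** Writing ln lambda as half of ln(lambda^2) lets the chain rule use lambda^2, the function known
    to be smooth. *)
Lemma dirder_ln_dilation p (v : tangent p) : smooth_at (fun q => lam q ^+ 2) p ->
  dirder (fun q => lam q ^+ 2) v =
  2 * lam p ^+ 2 * dirder (fun q => ln (lam q)) v.
Proof.
move=> s; have l0 q : 0 < lam q by exact: hlam.1.
have d := smooth_at_differentiable s.
set x := cmap (chart_at p) p in d; set psi := cinv (chart_at p) in d.
have psix : psi x = p by rewrite /psi /x cmapK //; exact: chart_atP.
have sx0 : 0 < ((fun q => lam q ^+ 2) \o psi) x by rewrite /= exprn_gt0.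
have hln := is_derive1_ln sx0.
have dln : differentiable (@ln R) (((fun q => lam q ^+ 2) \o psi) x).
  by apply/derivable1_diffP; case: hln.
have E : (fun q => ln (lam q)) \o psi =
    2^-1 *: (@ln R \o ((fun q => lam q ^+ 2) \o psi)).
  apply/funext => y /=.
  change (ln (lam (psi y)) = 2^-1 * ln (lam (psi y) ^+ 2)).
  by rewrite lnXn // -[ln _ *+ 2]mulr_natr mulrCA mulVf ?mulr1 // pnatr_eq0.
have dc := differentiable_comp d dln.
have dl : dirder (fun q => ln (lam q)) v =
    2^-1 * 'd (@ln R \o ((fun q => lam q ^+ 2) \o psi)) x v.
  rewrite /dirder -/psi -/x E.
  exact: (congr1 (@^~ v) (diffZ 2^-1 dc)).
have dc1 : 'd (@ln R \o ((fun q => lam q ^+ 2) \o psi)) x v =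
   'd (@ln R) (((fun q => lam q ^+ 2) \o psi) x)
     ('d ((fun q => lam q ^+ 2) \o psi) x v).
  exact: (congr1 (@^~ v) (diff_comp d dln)).
rewrite dl dc1 /dirder -/psi -/x.
set D := 'd _ x v.
rewrite deriv1E; last by case: hln.
rewrite derive1E; case: hln => _ ->.
change (D = 2 * lam p ^+ 2 * (2^-1 * (D * (lam (psi x) ^+ 2)^-1))).
rewrite psix; move: D => D; have lp : lam p != 0 by rewrite gt_eqF.
by field.
Qed.

(** The second fundamental form of the map [F], that is, the covariant derivative of F_*. *)
Definition second_form (X Y : vfield M) p : tangent (F p) :=
  nablaF (X p : tangent p) (push F Y) -
  differential F (nablaM (X p : tangent p) Y).

Lemma second_form_sym X Y p : smooth_field X p -> smooth_field Y p ->
  second_form X Y p = second_form Y X p.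
Proof.
move=> sX sY; have := pullback_torsion sF hN hP hM sX sY.
rewrite differentialB => h; rewrite /second_form.
rewrite -[nablaF (X p) _](subrK (nablaF (Y p : tangent p) (push F X))) h.
by rewrite addrAC [differential F _ - _]addrC addrK addrC.
Qed.

Lemma second_form_metric X Y Z p :
  smooth_at (fun q => lam q ^+ 2) p ->
  smooth_field X p -> smooth_field Y p -> smooth_field Z p ->
  (forall q, horiz gM F (Y q : tangent q)) ->
  (forall q, horiz gM F (Z q : tangent q)) ->
  dirder (fun q => lam q ^+ 2) (X p : tangent p) *
    gM p (Y p : tangent p) (Z p : tangent p) =
  gN (F p) (second_form X Y p) (push F Z p) +
  gN (F p) (second_form X Z p) (push F Y p).
Proof.
move=> s sX sY sZ hY hZ.
have [_ /(_ (X p : tangent p))] := pullback_metric sF hN hP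
   (smooth_along_push sF sY) (smooth_along_push sF sZ).
have -> : (fun q => gN (F q) (push F Y q) (push F Z q)) =
    (fun q => lam q ^+ 2 * gM q (Y q : tangent q) (Z q : tangent q)).
  by apply/funext => q; rewrite conformal_inner.
rewrite dirderM //; last exact: inner_smooth.
rewrite (lc_metric hM) // mulrDr conformal_inner //.
rewrite [gM p (Y p : tangent p) _]inner_sym conformal_inner // !innerBl.
rewrite [X in _ = _ + X]inner_sym -!/(push F _ p) mulrC => h.
(* The terms added to both sides are those with F_* of nabla_X Y and nabla_X Z, common to the two
   expansions of the derivative. *)
by apply: (addrI (gN (F p) (differential F (nablaM (X p : tangent p) Y)) (push F Z p) +
  gN (F p) (differential F (nablaM (X p : tangent p) Z)) (push F Y p))); lra.
Qed.

(** Adding the metric identities differentiated along X and Y and subtracting the one along Z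
    leaves, by symmetry, twice the left-hand side; the factor 2 cancels against the one in
    [dirder_ln_dilation]. *)
Lemma second_formE X Y Z p :
  smooth_at (fun q => lam q ^+ 2) p ->
  smooth_field X p -> smooth_field Y p -> smooth_field Z p ->
  (forall q, horiz gM F (X q : tangent q)) ->
  (forall q, horiz gM F (Y q : tangent q)) ->
  (forall q, horiz gM F (Z q : tangent q)) ->
  gN (F p) (second_form X Y p) (push F Z p) =
  lam p ^+ 2 *
   (dirder (fun q => ln (lam q)) (X p : tangent p) * gM p (Y p : tangent p) (Z p : tangent p) +
    dirder (fun q => ln (lam q)) (Y p : tangent p) * gM p (X p : tangent p) (Z p : tangent p) -
    dirder (fun q => ln (lam q)) (Z p : tangent p) * gM p (X p : tangent p) (Y p : tangent p)).
Proof.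
move=> s sX sY sZ hX hY hZ.
have := second_form_metric s sX sY sZ hY hZ.
have := second_form_metric s sY sX sZ hX hZ.
have := second_form_metric s sZ sX sY hX hY.
rewrite (second_form_sym sY sX) (second_form_sym sZ sX) (second_form_sym sZ sY).
rewrite !dirder_ln_dilation // => h1 h2 h3.
by rewrite !(mulrDr, mulrBr); lra.
Qed.

End ConformalSubmersion.

(** * Semi-invariant submersions *)

Section SemiInvariant.
Variables (R : realType) (m n : nat) (M : manifold R m) (N : manifold R n).
Variables (gM : metric M) (gN : metric N).
Variables (nablaM : conn_op (@id M)) (nablaN : conn_op (@id N)) (J : endo M).
Variables (F : M -> N) (nablaF : conn_op F) (lam : M -> R) (D1 : subspaces M).
Hypothesis hK : is_kahler gM nablaM J.
Hypothesis hN : is_levi_civita gN nablaN.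
Hypothesis hF : is_conformal_semi_invariant gM gN F J lam D1.
Hypothesis hP : is_pullback_connection nablaN nablaF.

Let hsub : is_submersion F := csi_submersion hF.
Let hM : is_levi_civita gM nablaM := kahler_levi_civita hK.
Let hcM : is_connection nablaM := lc_connection hM.
Local Notation D2 := (compl_D2 gM F D1).
Local Notation H := (horiz gM F).

(** The D_2-component of an arbitrary field, written through the two projections known to be smooth.
    As D_1 is vertical, the field and its vertical part have the same projection onto D_1. *)
Definition D2proj (X : vfield M) : vfield M := fun p =>
  X p - hproj gM F X p - Defs.proj gM D1 X p.

Lemma D2proj_smooth X p : smooth_field X p -> smooth_field (D2proj X) p.
Proof.
move=> sX; have sh := hproj_smooth gM hsub sX.
have sd := proj_smooth gM (csi_distribution hF) sX.
exact: smooth_alongB (smooth_alongB sX sh) sd.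
Qed.

Lemma inner_vert_horiz p (u v : tangent p) : vert F u -> H v -> gM p u v = 0.
Proof. by move=> vu [_ hv]; rewrite inner_sym hv. Qed.

Lemma D2projP X p : D2 (D2proj X p : tangent p) /\
  forall w : tangent p, D2 w -> gM p (X p - D2proj X p) w = 0.
Proof.
have [hh hv] := hprojP gM hsub X p.
have [Dd [_ od]] := projP gM (csi_distribution hF) X p.
have vd := csi_sub hF Dd.
have E w : gM p (X p - D2proj X p) w =
    gM p (hproj gM F X p) w + gM p (Defs.proj gM D1 X p) w.
  rewrite /D2proj !innerBl; ring.
split.
  split; first exact: (vertB hv vd).
  move=> w Dw; rewrite /D2proj addrAC innerBl od // sub0r.
  by rewrite inner_sym inner_vert_horiz ?oppr0 //; exact: (csi_sub hF).
move=> w [vw ow]; rewrite E inner_sym inner_vert_horiz // add0r.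
by rewrite inner_sym ow.
Qed.

Lemma vert_split p (w : tangent p) : vert F w ->
  exists d e : tangent p, [/\ D1 d, D2 e & w = d + e].
Proof.
move=> vw; have [Dd [_ od]] := projP gM (csi_distribution hF) (fun=> w) p.
exists (Defs.proj gM D1 (fun=> w) p), (w - Defs.proj gM D1 (fun=> w) p).
split=> //; last by rewrite addrC subrK.
by split=> //; apply: vertB => //; exact: (csi_sub hF Dd).
Qed.

Lemma J_skew p (u v : tangent p) : gM p (J p u) v = - gM p u (J p v).
Proof.
by rewrite -(kahler_hermitian hK (J p u)) (kahler_square hK) innerNl.
Qed.

Lemma J_D1 p (v : tangent p) : D1 v -> D1 (J p v : tangent p).
Proof. by move=> Dv; rewrite -(csi_D1 hF p); exists v. Qed.

(** JX is orthogonal to D_1 because J preserves D_1, and to J D_2 because J is an isometry; removing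
    its D_2-component makes it horizontal. *)
Lemma D2_horiz_split X p : H (X p : tangent p) ->
  mu gM F J D1 (J p (X p) - D2proj (endo_app J X) p : tangent p).
Proof.
move=> [_ hX]; have [PD PO] := D2projP (endo_app J X) p.
split; last first.
  move=> _ [e De <-]; rewrite innerBl (kahler_hermitian hK) (hX e De.1) sub0r.
  by rewrite inner_vert_horiz ?oppr0 //; [case: PD|exact: (csi_D2 hF)].
split=> // w /vert_split[d [e [Dd De ->]]].
rewrite innerDr (PO e De) addr0 innerBl J_skew hX ?oppr0 ?sub0r.
  by case: PD => _ ->; rewrite ?oppr0.
by apply: (csi_sub hF); exact: J_D1.
Qed.

Lemma mu_horiz p (v : tangent p) : mu gM F J D1 v -> H v.
Proof. by case. Qed.

Lemma D2_mu_orth p (v w : tangent p) : D2 v -> mu gM F J D1 w -> gM p v w = 0.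
Proof. by move=> [vv _] /mu_horiz; exact: inner_vert_horiz. Qed.

(** Replaces the pointwise choice in [Bpart] by a formula that is visibly smooth. *)
Lemma BpartE X : (forall p, H (X p : tangent p)) ->
  Bpart gM F J D1 X = D2proj (endo_app J X).
Proof.
move=> hX; apply/funext => p; apply: (component_eq (g := gM)).
- by move=> v w; exact: D2_mu_orth.
- by case: (D2projP (endo_app J X) p).
- exact: D2_horiz_split.
Qed.

Lemma CpartE X : (forall p, H (X p : tangent p)) ->
  Cpart gM F J D1 X = fun p => endo_app J X p - D2proj (endo_app J X) p.
Proof.
move=> hX; apply/funext => p; apply: (component_eq (g := gM)).
- by move=> v w mv Dw; rewrite inner_sym; exact: D2_mu_orth.
- exact: D2_horiz_split.
- by rewrite opprB addrC subrK; case: (D2projP (endo_app J X) p).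
Qed.

Lemma hproj_id X : (forall p, H (X p : tangent p)) -> hproj gM F X = X.
Proof.
move=> hX; apply/funext => p; apply: (hprojE (hX p)).
by rewrite subrr; exact: vert0.
Qed.

Lemma hproj_vert X : (forall p, vert F (X p : tangent p)) ->
  hproj gM F X = fun=> 0.
Proof.
move=> vX; apply/funext => p; apply: hprojE; last by rewrite subr0.
by split=> // w _; rewrite inner0l.
Qed.

Lemma vproj_horiz X : (forall p, H (X p : tangent p)) ->
  vproj gM F X = fun=> 0.
Proof.
move=> hX; apply/funext => p; rewrite (vproj_hproj _ hsub) hproj_id //.
by rewrite subrr.
Qed.

Lemma vproj_id X : (forall p, vert F (X p : tangent p)) -> vproj gM F X = X.
Proof.
move=> vX; apply/funext => p; rewrite (vproj_hproj _ hsub) hproj_vert //.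
by rewrite subr0.
Qed.

Lemma covder0 X : covder nablaM X (fun=> 0) = fun=> 0.
Proof. by apply/funext => p; exact: (conn0 hcM). Qed.

(** The second term of A differentiates the vertical part of [Y], which is the zero field. *)
Lemma oneill_horiz X Y : (forall p, H (X p : tangent p)) ->
  (forall p, H (Y p : tangent p)) ->
  oneill_A gM F nablaM X Y = vproj gM F (covder nablaM X Y).
Proof.
move=> hX hY; apply/funext => p; rewrite /oneill_A (hproj_id hX) (hproj_id hY).
rewrite (vproj_horiz hY) covder0 hproj_vert ?addr0 // => q; exact: vert0.
Qed.

Lemma oneill_vert X Y : (forall p, H (X p : tangent p)) ->
  (forall p, vert F (Y p : tangent p)) ->
  oneill_A gM F nablaM X Y = hproj gM F (covder nablaM X Y).
Proof.
move=> hX vY; apply/funext => p.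
rewrite /oneill_A (hproj_id hX) (hproj_vert vY) (vproj_id vY) covder0.
by rewrite vproj_id ?add0r // => q; exact: vert0.
Qed.

Lemma vprojD X Y p :
  vproj gM F (fun q => X q + Y q) p = vproj gM F X p + vproj gM F Y p.
Proof.
have [vX hX] := vprojP gM hsub X p; have [vY hY] := vprojP gM hsub Y p.
apply: vprojE; first exact: vertD.
by rewrite opprD addrACA; exact: horizD.
Qed.

(** * The two conditions expressed through the covariant derivative of Y along X *)

Section HorizontalFields.
Variables X Y : vfield M.
Hypotheses (GX : gsection H X) (GY : gsection H Y).

Let B := Bpart gM F J D1 Y.
Let C := Cpart gM F J D1 Y.

Let sJY p : smooth_field (endo_app J Y) p.
Proof. by apply: (kahler_smooth hK); exact: GY.1. Qed.

Lemma Bpart_smooth p : smooth_field B p.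
Proof. by rewrite /B BpartE; [exact: D2proj_smooth|exact: GY.2]. Qed.

Lemma Cpart_smooth p : smooth_field C p.
Proof.
rewrite /C CpartE; last exact: GY.2.
exact: (smooth_alongB (@sJY p) (D2proj_smooth (@sJY p))).
Qed.

Lemma Bpart_D2 p : D2 (B p : tangent p).
Proof. by rewrite /B BpartE; [case: (D2projP (endo_app J Y) p)|exact: GY.2]. Qed.

Lemma Cpart_mu p : mu gM F J D1 (C p : tangent p).
Proof.
by rewrite /C CpartE; [apply: D2_horiz_split; exact: GY.2|exact: GY.2].
Qed.

Lemma endo_split : (fun q => B q + C q) = endo_app J Y.
Proof.
apply/funext => q; rewrite /B /C BpartE ?CpartE; try exact: GY.2.
by rewrite addrC subrK.
Qed.

Lemma covder_endo :
  (fun q => covder nablaM X B q + covder nablaM X C q) =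
  endo_app J (covder nablaM X Y).
Proof.
apply/funext => q; rewrite /covder -(conn_add hcM).
- by rewrite endo_split (kahler_parallel hK) //; exact: GY.1.
- exact: Bpart_smooth.
- exact: Cpart_smooth.
Qed.

Lemma vertical_partE p :
  oneill_A gM F nablaM X C p + vproj gM F (covder nablaM X B) p =
  vproj gM F (endo_app J (covder nablaM X Y)) p.
Proof.
rewrite oneill_horiz; [|exact: GX.2|by move=> q; exact: mu_horiz (Cpart_mu q)].
by rewrite -covder_endo vprojD addrC.
Qed.

Variable W : vfield M.
Hypothesis GW : gsection D2 W.

(** The two sides of the second condition differ exactly by lambda^2 g(nabla_X Y, W), for all
    horizontal X, Y and all W in D_2; both directions of the theorem use this. *)
Lemma tension_identity p :
  lam p ^+ 2 * gM p (covder nablaM X Y p) (W p) =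
  lam p ^+ 2 *
    gM p (oneill_A gM F nablaM X B p
          - dirder (fun q => ln (lam q)) (C p : tangent p) *: X p
          + gM p (X p) (C p) *: gradient gM (fun q => ln (lam q)) p)
         (J p (W p))
  - gN (F p) (nablaF (X p : tangent p) (push F (endo_app J W))) (push F C p).
Proof.
have hX q : H (X q : tangent q) := GX.2 q.
have hC q : H (C q : tangent q) by exact: mu_horiz (Cpart_mu q).
have hJW q : H (J q (W q) : tangent q) by apply: (csi_D2 hF); exact: GW.2.
have sW q : smooth_field W q := GW.1 q.
have sJW q : smooth_field (endo_app J W) q by exact: (kahler_smooth hK).
have CJW q : gM q (C q : tangent q) (J q (W q)) = 0.
  by case: (Cpart_mu q) => _; apply; exists (W q) => //; exact: GW.2.
(* JW is horizontal, so it sees only the horizontal part A_X BY of nabla_X BY; and g(CY, JW)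
   vanishes identically, so metricity moves the derivative from CY to JW. *)
have E1 : gM p (covder nablaM X Y p) (W p) =
   gM p (oneill_A gM F nablaM X B p) (J p (W p)) -
   gM p (nablaM (X p : tangent p) (endo_app J W)) (C p).
  rewrite -(kahler_hermitian hK).
  have -> : J p (covder nablaM X Y p) = covder nablaM X B p + covder nablaM X C p.
    by rewrite -[LHS]/(endo_app J (covder nablaM X Y) p) -covder_endo.
  rewrite innerDl; congr (_ + _).
    rewrite oneill_vert; [|exact: hX|by move=> q; case: (Bpart_D2 q)].
    have [_ hv] := hprojP gM hsub (covder nablaM X B) p.
    by apply: subr0_eq; rewrite -innerBl inner_vert_horiz.
  have := lc_metric hM (X p : tangent p) (@Cpart_smooth p) (sJW p).
  have -> : (fun q => gM q (C q : tangent q) (endo_app J W q)) = fun=> 0.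
    by apply/funext => q; exact: CJW.
  rewrite dirder_cst inner_sym => /esym/eqP; rewrite addr_eq0 => /eqP.
  by rewrite inner_sym => ->; rewrite inner_sym.
(* If X vanishes at [p], smoothness of lambda^2 cannot be drawn from [dilation_smooth] applied to
   it, but every term is zero by linearity in that vector. *)
have [X0|X0] := eqVneq (X p : 'rV[R]_m) 0.
  have c0 V : smooth_field V p -> covder nablaM X V p = 0.
    by move=> sV; rewrite /covder X0; exact: (conn_vec0 hcM).
  have A0 : oneill_A gM F nablaM X B p = 0.
    rewrite oneill_vert; [|exact: hX|by move=> q; case: (Bpart_D2 q)].
    apply: hprojE; last by rewrite c0 ?subr0; [exact: vert0|exact: Bpart_smooth].
    by split=> // w _; rewrite inner0l.
  rewrite A0 c0 ?X0; last exact: GY.1.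
  rewrite (conn_vec0 hP.1); last first.
    exact: (smooth_along_push hsub.1 (sJW p)).
  by rewrite scaler0 !inner0l scale0r !subr0 addr0 inner0l.
have sl := dilation_smooth hsub hN hP (csi_conformal hF) (hX p) X0.
have E2 := second_formE hsub hM hN hP (csi_conformal hF) sl (GX.1 p) (sJW p)
  (@Cpart_smooth p) hX hJW hC.
have E3 : lam p ^+ 2 * gM p (nablaM (X p : tangent p) (endo_app J W)) (C p) =
    gN (F p) (nablaF (X p : tangent p) (push F (endo_app J W))) (push F C p) -
    gN (F p) (second_form nablaM nablaF X (endo_app J W) p) (push F C p).
  rewrite (conformal_inner hsub (csi_conformal hF)) // -innerBl /second_form.
  by rewrite opprB addrC subrK.
rewrite E1 mulrBr E3 E2 !innerDl innerNl !innerZl inner_gradient.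
(* Orthogonality of CY and JW removes the term with the derivative of ln lambda along X. *)
rewrite [gM p (endo_app J W p) _]inner_sym CJW.
ring.
Qed.

End HorizontalFields.

End SemiInvariant.

Theorem theorem3p3 (R : realType) (m n : nat)
    (M : manifold R m) (N : manifold R n) (gM : metric M) (gN : metric N)
    (nablaM : conn_op (@id M)) (nablaN : conn_op (@id N)) (J : endo M)
    (F : M -> N) (nablaF : conn_op F) (lam : M -> R) (D1 : subspaces M)
    (hK : is_kahler gM nablaM J) (hN : is_levi_civita gN nablaN)
    (hF : is_conformal_semi_invariant gM gN F J lam D1)
    (hP : is_pullback_connection nablaN nablaF) :
  let D2 := compl_D2 gM F D1 in
  let H := horiz gM F in
  let A := oneill_A gM F nablaM in
  let B := Bpart gM F J D1 in
  let C := Cpart gM F J D1 in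
  let lnlam : M -> R := fun q => ln (lam q) in
  defines_tot_geodesic_foliation nablaM H <->
  forall X Y W : vfield M, gsection H X -> gsection H Y -> gsection D2 W ->
    gsection D2 (fun p => A X (C Y) p
                          + vproj gM F (covder nablaM X (B Y)) p) /\
    forall p : M,
      lam p ^+ 2 *
        gM p (A X (B Y) p - dirder lnlam (C Y p) *: X p
              + gM p (X p) (C Y p) *: gradient gM lnlam p)
             (J p (W p))
      = gN (F p) (nablaF p (X p) (push F (endo_app J W)))
           (push F (C Y) p).
Proof.
move=> D2 H A B C lnlam; have hsub := csi_submersion hF.
have hcM := lc_connection (kahler_levi_civita hK).
have sZ X Y p : gsection H X -> gsection H Y ->
    smooth_field (covder nablaM X Y) p.
  by move=> GX GY; apply: (conn_smooth hcM); [exact: GX.1|exact: GY.1].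
split=> [tg X Y W GX GY GW|h X Y GX GY].
  have GZ : gsection H (covder nablaM X Y) := tg X Y GX GY.
  (* As nabla_X Y is horizontal, J maps it into D_2 + mu, so the vertical part of its image is the
     D_2-component. *)
  have PZ : (fun p => A X (C Y) p + vproj gM F (covder nablaM X (B Y)) p) =
      D2proj gM F D1 (endo_app J (covder nablaM X Y)).
    apply/funext => p; rewrite (vertical_partE hK hF GX GY).
    apply: vprojE; first exact: (D2projP hF _ p).1.1.
    exact: mu_horiz (D2_horiz_split hK hF (GZ.2 p)).
  split=> [|p].
    rewrite PZ; split=> p; last by case: (D2projP hF (endo_app J (covder nablaM X Y)) p).
    by apply: (D2proj_smooth hF); apply: (kahler_smooth hK); exact: GZ.1.
  have := tension_identity hK hN hF hP GX GY GW p.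
  rewrite inner_sym (inner_vert_horiz (GW.2 p).1 (GZ.2 p)) mulr0.
  by move/esym/subr0_eq.
split=> [p|p]; first exact: sZ.
split=> // w /(vert_split hF)[d [e [Dd De ->]]].
pose W := D2proj gM F D1 (covder nablaM X Y).
have GW : gsection D2 W.
  split=> q; first by apply: (D2proj_smooth hF); exact: sZ.
  by case: (D2projP hF (covder nablaM X Y) q).
have [[_ /(_ p) [vS oS]] tension] := h X Y W GX GY GW.
(* The product equals g(J nabla_X Y, Jd). Here Jd lies in D_1, while the first condition puts the
   vertical part of J nabla_X Y in D_2. *)
have Dd0 : gM p (covder nablaM X Y p) d = 0.
  have DJd := J_D1 hF Dd.
  rewrite -(kahler_hermitian hK) -(oS _ DJd) (vertical_partE hK hF GX GY).
  have [vv hv] := vprojP gM hsub (endo_app J (covder nablaM X Y)) p.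
  apply: subr0_eq; rewrite -innerBl inner_sym.
  exact: inner_vert_horiz (csi_sub hF DJd) hv.
have [DW oW] := D2projP hF (covder nablaM X Y) p.
(* By the second condition [tension_identity] reduces to lambda^2 g(nabla_X Y, W) = 0, and g(nabla_X
   Y, W) = g(W, W) by the choice of [W]. *)
have W0 : W p = 0.
  apply: (@inner_eq0 _ _ _ gM p).
  have := tension_identity hK hN hF hP GX GY GW p.
  rewrite tension subrr => /eqP; rewrite mulf_eq0 expf_eq0 /= gt_eqF /=.
    by move/eqP => ZW0; rewrite -[RHS]ZW0; symmetry; apply: subr0_eq;
      rewrite -innerBl; exact: oW.
  exact: (csi_conformal hF).1.
rewrite innerDr [X in X + _]Dd0 add0r.
by have := oW e De; rewrite -/W W0 subr0.
Qed.
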